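(* Let $\ell$ be a positive integer. For $n\ge1$ let $B_n^{(\ell)*}=\sum_{r=0}^{n}\binom{n+r}{2r}\frac{B_r^{(\ell)}}{n+r}$, where $\sum_{r\ge0}B_r^{(\ell)}\frac{z^r}{r!}=\left(\frac{z}{e^z-1}\right)^\ell$. Let $\rho_1(t)=\frac{\pi}{2}\operatorname{sech}^2(\pi t)$ and $\rho_\ell$ its $\ell$-fold convolution ($\rho_\ell(t)=\int_{-\infty}^\infty\rho_{\ell-1}(u)\rho_1(t-u)\,du$). Then the generating function $F_{B^*}(z;\ell)=\sum_{n=1}^\infty B_n^{(\ell)*}z^n$, viewed as a formal power series in $z$ (with the right-hand side understood through its expansion as $z\to0^+$), is given by $$F_{B^*}(z;\ell)=-\frac12\log z-\frac12\log\left|x-\frac{\ell}{2}\right|-\frac12\int_0^\infty\log(1+bu^2)\rho_\ell(u)\,du,$$ where $x=z+1/z+\ell-2$ and $b=(x-\ell/2)^{-2}$. *)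

(* Defs.v *)
From Stdlib Require Import Reals.
From Coquelicot Require Import Coquelicot.
Open Scope R_scope.

Definition bern_gen (l : nat) (z : R) : R :=
  if Req_EM_T z 0 then 1 else (z / (exp z - 1)) ^ l.

(* Higher-order (Noerlund) Bernoulli numbers B_r^(l):
   sum_r B_r^(l) z^r / r! = (z/(e^z-1))^l, i.e. B_r^(l) is the r-th derivative at 0. *)
Definition bernoulli_l (l r : nat) : R := Derive_n (bern_gen l) r 0.

Definition Bstar (l n : nat) : R :=
  sum_n (fun r => Binomial.C (n + r) (2 * r) * bernoulli_l l r / INR (n + r)) n.

Definition rho1 (t : R) : R := (PI / 2) / (cosh (PI * t)) ^ 2.

(* rho_aux k = rho_{k+1}; rho_{k+2}(t) = int_{-oo}^{oo} rho_{k+1}(u) rho_1(t-u) du *)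
Fixpoint rho_aux (k : nat) : R -> R :=
  match k with
  | O => rho1
  | S k' => fun t => RInt_gen (fun u => rho_aux k' u * rho1 (t - u))
                        (Rbar_locally m_infty) (Rbar_locally p_infty)
  end.

(* rho_l, the l-fold convolution of rho_1 (meaningful for l >= 1). *)
Definition rho (l : nat) : R -> R := rho_aux (l - 1).

Definition rhs_F (l : nat) (z : R) : R :=
  let x := z + / z + INR l - 2 in
  let b := / (x - INR l / 2) ^ 2 in
  - (1/2) * ln z - (1/2) * ln (Rabs (x - INR l / 2))
  - (1/2) * RInt_gen (fun u => ln (1 + b * u ^ 2) * rho l u)
                     (at_point 0) (Rbar_locally p_infty).

(* Main.v *)
(* Write w = (1 - z)^2 / z, v = 1 / w and a = l / 2. Expanding formally in 1 / w, the series in z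
   is - log (1 - z) + sum_{r >= 1} B_r v^r / (2 r), while the right-hand side equals
   - log (1 - z) - (1/2) int Re log (1 + v (a + i u)) rho_l(u) du. Taylor expansion of the logarithm
   with remainder reduces the claim to the moment identity B_r = int Re (- (a + i u))^r rho_l(u) du.

   These moments are the derivatives at 0 of z |-> int Re exp (- z (a + i u)) rho_l(u) du
   = e^{- l z / 2} int cos (z u) rho_l(u) du, so it is enough to know that the cosine transform of
   rho_l is ((s / 2) / sinh (s / 2))^l. It is multiplicative under convolution with the even
   function rho_1, and for l = 1 it is found by shifting the line of integration of
   (sinh (s z) - s z) / sin^2 (PI z) from Re z = 0, where the real part vanishes, to Re z = 1/2,
   where 1 / sin^2 (PI z) = 1 / cosh^2 (PI t). *)
From Corelib Require Import ssreflect.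
Require Import Defs.
From Stdlib Require Import Reals Lra Lia FunctionalExtensionality.
From Coquelicot Require Import Coquelicot.
Open Scope R_scope.

(** * Integrals over the line of exponentially decaying functions *)

(* [ring] needs the equality to be at type [R], not at a Coquelicot structure on [R]. *)
Ltac as_R := match goal with |- ?x = ?y => change (@eq R x y) end.

(** Contour deformation and Fubini are both replaced by differentiation in one real parameter. For
    the contour, the Cauchy-Riemann equations say that the [y]-derivative of the integral of the
    real part from [y + i e] to [y + i r] is the difference of the imaginary parts at the two ends.
    Only these need estimates: [O(e)] at the lower end, because the kernel is real on the real axis,
    and [O(1/r)] at the upper one. For the convolution, the integral of [cos (s t) * conv_rho1 g t]
    over [[-T, T]] and a single integral in [u] both vanish at [T = 0] and have the same derivative
    in [T], hence agree; the limit [T -> oo] then needs only an error bound.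

    Dominated convergence is replaced by a remainder that is quadratic in the increment, with an
    exponentially decaying weight in [u]. This is why functions are tracked by a decay rate: the
    densities are [O(exp (- 2 |u|))], while polynomial factors and truncation errors cost at most a
    factor [exp |u|]. *)

Definition halfline_lim (f : R -> R) (L : R) : Prop :=
  filterlim (fun x => RInt f 0 x) (Rbar_locally p_infty) (locally L).

Lemma continuous_ex_RInt (f : R -> R) (a b : R) :
  (forall u, continuous f u) -> ex_RInt f a b.
Proof. intros Hf; apply: ex_RInt_continuous; auto. Qed.

Lemma RInt_Chasles_R (f : R -> R) (a b c : R) :
  (forall u, continuous f u) -> RInt f a c = RInt f a b + RInt f b c.
Proof.
intros Hf; symmetry; apply: (RInt_Chasles f a b c); now apply continuous_ex_RInt.
Qed.

Lemma RInt_flip (f : R -> R) (x : R) :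
  (forall u, continuous f u) -> RInt (fun u => f (- u)) 0 (- x) = - RInt f 0 x.
Proof.
intros Hf; apply is_RInt_unique.
assert (H : is_RInt f (- 0) (- (- x)) (RInt f 0 x)).
  rewrite Ropp_involutive Ropp_0; apply: RInt_correct; now apply continuous_ex_RInt.
apply is_RInt_comp_opp, is_RInt_opp in H.
apply: is_RInt_ext H; intros y _; unfold opp; simpl; ring.
Qed.

Lemma halfline_RInt_gen (f : R -> R) (L : R) :
  (forall u, continuous f u) -> halfline_lim f L ->
  is_RInt_gen f (at_point 0) (Rbar_locally p_infty) L.
Proof.
intros Hf HL P HP.
apply Filter_prod with (fun x => x = 0) (fun x => P (RInt f 0 x)).
- reflexivity.
- exact (HL P HP).
- intros x y -> Hy; exists (RInt f 0 y); split; [|exact Hy].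
  apply: RInt_correct; now apply continuous_ex_RInt.
Qed.

Lemma halfline_RInt_gen_opp (f : R -> R) (L : R) :
  (forall u, continuous f u) -> halfline_lim (fun u => f (- u)) L ->
  is_RInt_gen f (Rbar_locally m_infty) (at_point 0) L.
Proof.
intros Hf HL P HP.
destruct (HL P HP) as [M HM].
apply Filter_prod with (fun x => x < - M) (fun x => x = 0).
- now exists (- M).
- reflexivity.
- intros x y Hx ->; exists (RInt f x 0); split.
    apply: RInt_correct; now apply continuous_ex_RInt.
  rewrite -(Ropp_involutive (RInt f x 0)).
  replace (- RInt f x 0) with (RInt f 0 x).
    rewrite -RInt_flip //; apply HM; lra.
  rewrite -(opp_RInt_swap f); [unfold opp; simpl; ring|now apply continuous_ex_RInt].
Qed.

Lemma continuous_flip (f : R -> R) :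
  (forall u, continuous f u) -> forall u, continuous (fun v => f (- v)) u.
Proof.
intros Hf u; apply: continuous_comp; [|apply Hf].
apply: (@continuous_opp R_UniformSpace R_AbsRing R_NormedModule (fun y => y)).
apply continuous_id.
Qed.

Lemma exp_le_compat (x y : R) : x <= y -> exp x <= exp y.
Proof.
intros [H| ->]; [apply Rlt_le; now apply exp_increasing|apply Rle_refl].
Qed.

Lemma RInt_exp_decay (k x y : R) : 0 < k ->
  is_RInt (fun u => exp (- (k * u))) x y (exp (- (k * x)) / k - exp (- (k * y)) / k).
Proof.
intros Hk.
replace (exp (- (k * x)) / k - exp (- (k * y)) / k) with
  (minus (- (exp (- (k * y)) / k)) (- (exp (- (k * x)) / k)))
  by (unfold minus, plus, opp; simpl; ring).
apply: (is_RInt_derive (fun u => - (exp (- (k * u)) / k))).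
- intros u _; auto_derive; [lra|field; lra].
- intros u _; apply: ex_derive_continuous; now auto_derive.
Qed.

Lemma RInt_abs_exp_decay (f : R -> R) (C k x y : R) :
  0 < k -> (forall u, continuous f u) -> 0 <= x <= y ->
  (forall u, 0 <= u -> Rabs (f u) <= C * exp (- (k * u))) ->
  Rabs (RInt f x y) <= C / k * exp (- (k * x)).
Proof.
intros Hk Hf Hxy Hb.
assert (HC : 0 <= C).
  generalize (Hb 0 (Rle_refl 0)) (Rabs_pos (f 0)).
  rewrite Rmult_0_r Ropp_0 exp_0; lra.
apply Rle_trans with (C * (exp (- (k * x)) / k - exp (- (k * y)) / k)).
- apply: (norm_RInt_le f (fun u => C * exp (- (k * u))) x y).
  + lra.
  + intros u Hu; apply Hb; lra.
  + apply: RInt_correct; now apply continuous_ex_RInt.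
  + apply: (is_RInt_scal (fun u => exp (- (k * u)))); now apply RInt_exp_decay.
- assert (0 <= C * (exp (- (k * y)) / k)).
    apply Rmult_le_pos; [easy|]; apply Rdiv_le_0_compat; [|easy].
    apply Rlt_le, exp_pos.
  unfold Rdiv in *; nra.
Qed.

Lemma exp_decay_small (C k eps : R) : 0 < k -> 0 < eps ->
  exists M, 0 <= M /\ forall x, M <= x -> C * exp (- (k * x)) < eps.
Proof.
intros Hk He.
exists (Rabs C / (eps * k)); split.
  apply Rdiv_le_0_compat; [apply Rabs_pos|nra].
intros x Hx.
assert (H0 : 0 <= Rabs C / (eps * k)).
  apply Rdiv_le_0_compat; [apply Rabs_pos|nra].
assert (H1 := exp_ineq1_le (k * x)).
assert (H2 : Rabs C <= eps * (k * x)).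
  apply Rmult_le_compat_r with (r := eps * k) in Hx; [|nra].
  replace (Rabs C / (eps * k) * (eps * k)) with (Rabs C) in Hx by (field; nra).
  lra.
rewrite exp_Ropp.
apply Rmult_lt_reg_r with (exp (k * x)); [apply exp_pos|].
rewrite Rmult_assoc Rinv_l; [|apply Rgt_not_eq, exp_pos].
generalize (Rle_abs C); nra.
Qed.

(** Cauchy's criterion gives [L]; letting the upper end tend to infinity in the bound on a segment
    gives the rate, which later makes limits uniform in a parameter. *)
Lemma halfline_lim_tail (f : R -> R) (C k : R) :
  0 < k -> (forall u, continuous f u) ->
  (forall u, 0 <= u -> Rabs (f u) <= C * exp (- (k * u))) ->
  exists L, halfline_lim f L /\
    forall x, 0 <= x -> Rabs (RInt f 0 x - L) <= C / k * exp (- (k * x)).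
Proof.
intros Hk Hf Hb.
assert (Hch : forall x y, 0 <= x <= y ->
    Rabs (RInt f 0 y - RInt f 0 x) <= C / k * exp (- (k * x))).
  intros x y Hxy.
  rewrite (RInt_Chasles_R f 0 x y Hf).
  replace (RInt f 0 x + RInt f x y - RInt f 0 x) with (RInt f x y) by lra.
  now apply RInt_abs_exp_decay.
assert (HL : exists L, halfline_lim f L).
  apply (@filterlim_locally_cauchy R R_CompleteSpace (Rbar_locally p_infty) _
           (fun x => RInt f 0 x)); intros eps.
  destruct (exp_decay_small (C / k) k eps Hk (cond_pos eps)) as [M [HM0 HM]].
  exists (fun x => M < x); split; [now exists M|].
  intros x y Hx Hy; unfold ball; simpl; unfold AbsRing_ball, abs, minus, plus, opp; simpl.
  destruct (Rle_dec x y) as [H|H].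
  - apply Rle_lt_trans with (2 := HM x (Rlt_le _ _ Hx)); apply Hch; lra.
  - rewrite Rabs_minus_sym.
    apply Rle_lt_trans with (2 := HM y (Rlt_le _ _ Hy)); apply Hch; lra.
destruct HL as [L HL]; exists L; split; [exact HL|].
intros x Hx.
rewrite Rabs_minus_sym.
assert (Hl : filterlim (fun y => Rabs (RInt f 0 y - RInt f 0 x)) (Rbar_locally p_infty)
    (locally (Rabs (L - RInt f 0 x)))).
  apply: (filterlim_comp _ _ _ _ Rabs _ (locally (L - RInt f 0 x))).
    apply: (filterlim_comp _ _ _ _ (fun v => v - RInt f 0 x) _ (locally L)); [exact HL|].
    apply: (continuous_minus (fun v => v) (fun _ => RInt f 0 x)).
      apply continuous_id.
    apply continuous_const.
  apply: (continuous_Rabs).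
apply: (filterlim_le (F := Rbar_locally p_infty) _ (fun _ => C / k * exp (- (k * x))) (Finite _) (Finite _) _ Hl).
  exists x; intros y Hy; apply Hch; lra.
apply filterlim_const.
Qed.

(* The full-line integral is handled through the even part on a half line, so that
   reflection invariance is built in. *)
Definition line_lim (f : R -> R) (L : R) : Prop := halfline_lim (fun u => f u + f (- u)) L.

(** The same [RInt_gen] as in [rho_aux], so that the recursion for [rho] holds by conversion. *)
Definition lineint (f : R -> R) : R :=
  RInt_gen f (Rbar_locally m_infty) (Rbar_locally p_infty).

(** The rate is explicit and the constant hidden: sums and multiples keep the rate. Continuity is
    bundled so that every integral over a segment exists. *)
Definition expdecay (k : R) (f : R -> R) : Prop :=
  (forall u, continuous f u) /\ exists C, forall u, Rabs (f u) <= C * exp (- (k * Rabs u)).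

Lemma halfline_lim_plus (f g : R -> R) (a b : R) :
  (forall u, continuous f u) -> (forall u, continuous g u) ->
  halfline_lim f a -> halfline_lim g b -> halfline_lim (fun u => f u + g u) (a + b).
Proof.
intros Hf Hg Ha Hb.
unfold halfline_lim.
apply (filterlim_ext (fun x => plus (RInt f 0 x) (RInt g 0 x))).
  intros x; symmetry; apply: RInt_plus; now apply continuous_ex_RInt.
apply: filterlim_comp_2 Ha Hb _.
apply: filterlim_plus.
Qed.

Lemma halfline_lim_scal (f : R -> R) (c a : R) :
  (forall u, continuous f u) ->
  halfline_lim f a -> halfline_lim (fun u => c * f u) (c * a).
Proof.
intros Hf Ha.
unfold halfline_lim.
apply (filterlim_ext (fun x => scal c (RInt f 0 x))).
  intros x; symmetry; apply: RInt_scal; now apply continuous_ex_RInt.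
apply: filterlim_comp Ha _.
apply: filterlim_scal_r.
Qed.

Lemma halfline_lim_ext (f g : R -> R) (a : R) :
  (forall u, f u = g u) -> halfline_lim f a -> halfline_lim g a.
Proof.
intros H; apply filterlim_ext; intros x; apply RInt_ext; auto.
Qed.

Lemma halfline_lim_unique (f : R -> R) (a b : R) :
  halfline_lim f a -> halfline_lim f b -> a = b.
Proof. intros Ha Hb; apply: (filterlim_locally_unique _ _ _ Ha Hb). Qed.

(** Reduces [RInt_gen] to a limit of [RInt] on one half line, after which linearity and reflection
    of [lineint] follow from uniqueness of that limit. *)
Lemma expdecay_line (f : R -> R) (C k : R) :
  0 < k -> (forall u, continuous f u) ->
  (forall u, Rabs (f u) <= C * exp (- (k * Rabs u))) ->
  line_lim f (lineint f) /\ Rabs (lineint f) <= 2 * C / k /\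
  is_RInt_gen f (Rbar_locally m_infty) (Rbar_locally p_infty) (lineint f).
Proof.
intros Hk Hf Hb.
destruct (halfline_lim_tail f C k Hk Hf) as [L1 [HL1 B1]].
  intros u Hu; generalize (Hb u); rewrite (Rabs_pos_eq u); auto.
destruct (halfline_lim_tail (fun u => f (- u)) C k Hk (continuous_flip f Hf)) as [L2 [HL2 B2]].
  intros u Hu; generalize (Hb (- u)); rewrite Rabs_Ropp (Rabs_pos_eq u); auto.
assert (HG := is_RInt_gen_Chasles f 0 L2 L1 (halfline_RInt_gen_opp f L2 Hf HL2)
                (halfline_RInt_gen f L1 Hf HL1)).
assert (HI : lineint f = L1 + L2).
  unfold lineint; rewrite (is_RInt_gen_unique f _ HG); unfold plus; simpl; ring.
split; [|split].
- rewrite HI; apply halfline_lim_plus; auto; now apply continuous_flip.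
- rewrite HI.
  generalize (B1 0 (Rle_refl _)) (B2 0 (Rle_refl _)).
  rewrite !RInt_point Rmult_0_r Ropp_0 exp_0 /zero /= => H1 H2.
  replace (2 * C / k) with (C / k * 1 + C / k * 1) by (field; lra).
  apply Rle_trans with (1 := Rabs_triang _ _).
  replace (Rabs L1) with (Rabs (0 - L1)) by (rewrite Rminus_0_l Rabs_Ropp; auto).
  replace (Rabs L2) with (Rabs (0 - L2)) by (rewrite Rminus_0_l Rabs_Ropp; auto).
  lra.
- rewrite HI Rplus_comm; exact HG.
Qed.

Lemma expdecay_line_lim (k : R) (f : R -> R) :
  0 < k -> expdecay k f -> line_lim f (lineint f).
Proof. intros Hk [Hf [C HC]]; now apply (expdecay_line f C k). Qed.

Lemma lineint_bound (k C : R) (f : R -> R) :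
  0 < k -> (forall u, continuous f u) ->
  (forall u, Rabs (f u) <= C * exp (- (k * Rabs u))) -> Rabs (lineint f) <= 2 * C / k.
Proof. intros; now apply (expdecay_line f C k). Qed.

Lemma lineint_ext (f g : R -> R) : (forall u, f u = g u) -> lineint f = lineint g.
Proof. intros H; f_equal; now apply functional_extensionality. Qed.

(** Link to the integral over [[0, oo)] that occurs in [rhs_F]. *)
Lemma lineint_even_half (k : R) (f : R -> R) :
  0 < k -> expdecay k f -> (forall u, f (- u) = f u) ->
  is_RInt_gen f (at_point 0) (Rbar_locally p_infty) (lineint f / 2).
Proof.
intros Hk Hf He.
apply halfline_RInt_gen; [apply Hf|].
apply (halfline_lim_ext (fun u => / 2 * (f u + f (- u)))).
  intros u; rewrite He; field.
unfold Rdiv; rewrite Rmult_comm.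
apply halfline_lim_scal.
  intros u; apply: (continuous_plus f (fun v => f (- v))); [apply Hf|apply continuous_flip, Hf].
now apply (expdecay_line_lim k).
Qed.

Lemma lineint_flip (k : R) (f : R -> R) :
  0 < k -> expdecay k f -> lineint (fun u => f (- u)) = lineint f.
Proof.
intros Hk Hf.
apply (halfline_lim_unique (fun u => f u + f (- u))).
- apply (halfline_lim_ext (fun u => f (- u) + f (- - u))).
    intros u; rewrite Ropp_involutive; ring.
  apply (expdecay_line_lim k (fun u => f (- u))); [easy|].
  destruct Hf as [Hf [C HC]]; split; [now apply continuous_flip|].
  exists C; intros u; generalize (HC (- u)); now rewrite Rabs_Ropp.
- now apply (expdecay_line_lim k).
Qed.

Lemma expdecay_plus (k : R) (f g : R -> R) :
  expdecay k f -> expdecay k g -> expdecay k (fun u => f u + g u).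
Proof.
intros [Hf [C HC]] [Hg [D HD]]; split.
  intros u; now apply: (continuous_plus f g).
exists (C + D); intros u; apply Rle_trans with (1 := Rabs_triang _ _).
generalize (HC u) (HD u); lra.
Qed.

Lemma expdecay_scal (k c : R) (f : R -> R) :
  expdecay k f -> expdecay k (fun u => c * f u).
Proof.
intros [Hf [C HC]]; split.
  intros u; apply: (continuous_mult (fun _ => c) f); [apply continuous_const|apply Hf].
exists (Rabs c * C); intros u; rewrite Rabs_mult Rmult_assoc.
apply Rmult_le_compat_l; [apply Rabs_pos|apply HC].
Qed.

Lemma expdecay_mult_bounded (k M : R) (f g : R -> R) :
  expdecay k f -> (forall u, continuous g u) -> (forall u, Rabs (g u) <= M) ->
  expdecay k (fun u => g u * f u).
Proof.
intros [Hf [C HC]] Hg HM; split.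
  intros u; now apply: (continuous_mult g f).
exists (M * C); intros u; rewrite Rabs_mult Rmult_assoc.
apply Rmult_le_compat; auto using Rabs_pos.
Qed.

Lemma continuous_flip_plus (f : R -> R) : (forall u, continuous f u) ->
  forall u, continuous (fun v => f v + f (- v)) u.
Proof.
intros Hf u; apply: (continuous_plus f (fun v => f (- v))); [apply Hf|now apply continuous_flip].
Qed.

Lemma lineint_plus (k : R) (f g : R -> R) :
  0 < k -> expdecay k f -> expdecay k g ->
  lineint (fun u => f u + g u) = lineint f + lineint g.
Proof.
intros Hk Hf Hg.
apply (halfline_lim_unique (fun u => (f u + g u) + (f (- u) + g (- u)))).
- now apply (expdecay_line_lim k (fun u => f u + g u)); [|apply expdecay_plus].
- apply (halfline_lim_ext (fun u => (f u + f (- u)) + (g u + g (- u)))).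
    intros u; ring.
  apply halfline_lim_plus.
  + apply continuous_flip_plus, Hf.
  + apply continuous_flip_plus, Hg.
  + now apply (expdecay_line_lim k).
  + now apply (expdecay_line_lim k).
Qed.

Lemma lineint_scal (k c : R) (f : R -> R) :
  0 < k -> expdecay k f -> lineint (fun u => c * f u) = c * lineint f.
Proof.
intros Hk Hf.
apply (halfline_lim_unique (fun u => c * f u + c * f (- u))).
- now apply (expdecay_line_lim k (fun u => c * f u)); [|apply expdecay_scal].
- apply (halfline_lim_ext (fun u => c * (f u + f (- u)))).
    intros u; ring.
  apply halfline_lim_scal.
  + apply continuous_flip_plus, Hf.
  + now apply (expdecay_line_lim k).
Qed.

Lemma lineint_minus (k : R) (f g : R -> R) :
  0 < k -> expdecay k f -> expdecay k g ->
  lineint (fun u => f u - g u) = lineint f - lineint g.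
Proof.
intros Hk Hf Hg.
rewrite (lineint_ext _ (fun u => f u + (-1) * g u)); [|intros u; ring].
rewrite (lineint_plus k); [|easy|easy|now apply expdecay_scal].
rewrite (lineint_scal k) //; ring.
Qed.

Lemma expdecay_weaken (j k : R) (f : R -> R) :
  j <= k -> expdecay k f -> expdecay j f.
Proof.
intros Hjk [Hf [C HC]]; split; [easy|].
exists C; intros u; apply Rle_trans with (1 := HC u).
assert (HC0 : 0 <= C).
  generalize (HC 0) (Rabs_pos (f 0)); rewrite Rabs_R0 Rmult_0_r Ropp_0 exp_0; lra.
apply Rmult_le_compat_l; [easy|].
apply exp_le_compat; generalize (Rabs_pos u); nra.
Qed.

(** * Decay and regularity of [rho1] and of its iterated convolutions *)

Lemma cosh_ge_1 (x : R) : 1 <= cosh x.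
Proof.
unfold cosh; generalize (exp_ineq1_le x) (exp_ineq1_le (- x)); lra.
Qed.

Lemma rho1_ex_derive (t : R) :
  is_derive rho1 t (- PI ^ 2 * sinh (PI * t) / cosh (PI * t) ^ 3).
Proof.
assert (Hc := cosh_ge_1 (PI * t)).
unfold rho1; auto_derive; [apply Rgt_not_eq; nra|field; nra].
Qed.

Lemma cosh_ge_exp (x : R) : exp (Rabs x) / 2 <= cosh x.
Proof.
unfold cosh; generalize (exp_pos x) (exp_pos (- x)); intros H1 H2.
unfold Rabs; destruct (Rcase_abs x); lra.
Qed.

Lemma sinh_le_cosh (x : R) : Rabs (sinh x) <= cosh x.
Proof.
unfold sinh, cosh; generalize (exp_pos x) (exp_pos (- x)); intros H1 H2.
apply Rabs_le; lra.
Qed.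

Lemma rho1_continuous (t : R) : continuous rho1 t.
Proof. apply: ex_derive_continuous; eexists; apply rho1_ex_derive. Qed.

Lemma rho1_even (t : R) : rho1 (- t) = rho1 t.
Proof. unfold rho1, cosh; rewrite Ropp_mult_distr_r_reverse Ropp_involutive; f_equal; f_equal; lra. Qed.

(** From [cosh x >= exp |x| / 2] the sharper bound is [2 PI exp (- 2 PI |t|)]; the constants [8] and
    [4] come from [PI <= 4] and [2 <= PI]. *)
Lemma rho1_bound (t : R) : Rabs (rho1 t) <= 8 * exp (- (4 * Rabs t)).
Proof.
assert (HP := PI_RGT_0); assert (H4 := PI_4).
assert (HP3 := PI2_3_2).
assert (Hc := cosh_ge_exp (PI * t)); assert (Hc1 := cosh_ge_1 (PI * t)).
unfold rho1; rewrite Rabs_pos_eq; last by apply Rdiv_le_0_compat; nra.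
rewrite Rabs_mult (Rabs_pos_eq PI) in Hc; [|lra].
assert (H : exp (2 * Rabs t) <= exp (PI * Rabs t)).
  apply exp_le_compat; generalize (Rabs_pos t); nra.
assert (E : exp (4 * Rabs t) = exp (2 * Rabs t) ^ 2).
  simpl; rewrite Rmult_1_r -exp_plus; f_equal; ring.
rewrite exp_Ropp E.
assert (He := exp_pos (2 * Rabs t)).
apply Rmult_le_reg_r with (cosh (PI * t) ^ 2); [nra|].
apply Rmult_le_reg_r with (exp (2 * Rabs t) ^ 2); [nra|].
field_simplify; [|nra|nra].
nra.
Qed.

Lemma lipschitz_of_derive (f df : R -> R) (M x y : R) :
  (forall t, is_derive f t (df t)) -> (forall t, Rabs (df t) <= M) ->
  Rabs (f y - f x) <= M * Rabs (y - x).
Proof.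
intros Hd HM.
destruct (MVT_gen f x y df) as [c [_ Hc]].
- intros t _; apply Hd.
- intros t _; apply continuity_pt_filterlim; apply: ex_derive_continuous; eexists; apply Hd.
- rewrite Hc Rabs_mult; apply Rmult_le_compat_r; [apply Rabs_pos|apply HM].
Qed.

(** The derivative is at most [PI ^ 2 <= 16], because [|sinh| <= cosh <= cosh ^ 3]. *)
Lemma rho1_lipschitz (x y : R) : Rabs (rho1 y - rho1 x) <= 16 * Rabs (y - x).
Proof.
apply (lipschitz_of_derive _ _ _ _ _ rho1_ex_derive); intros t.
assert (HP := PI_RGT_0); assert (H4 := PI_4).
assert (Hc1 := cosh_ge_1 (PI * t)); assert (Hs := sinh_le_cosh (PI * t)).
unfold Rdiv; rewrite (Rabs_mult (- PI ^ 2 * _)) (Rabs_mult (- PI ^ 2)) Rabs_Ropp (Rabs_pos_eq (PI ^ 2)); [|nra].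
rewrite Rabs_inv (Rabs_pos_eq (cosh _ ^ 3)); [|apply pow_le; lra].
apply Rmult_le_reg_r with (cosh (PI * t) ^ 3); [apply pow_lt; lra|].
rewrite Rmult_assoc Rinv_l; [|apply pow_nonzero; lra].
assert (cosh (PI * t) <= cosh (PI * t) ^ 3) by (simpl; nra).
assert (PI ^ 2 <= 16) by nra.
generalize (Rabs_pos (sinh (PI * t))); nra.
Qed.

Definition conv_rho1 (g : R -> R) (t : R) : R := lineint (fun u => g u * rho1 (t - u)).

(** An open range of rates, because the estimate for a convolution spends part of the rate of [g];
    an open range is stable under this. *)
Definition rholike (g : R -> R) : Prop :=
  (forall u, g (- u) = g u) /\ forall k, 0 < k < 4 -> expdecay k g.

Lemma rho1_rholike : rholike rho1.
Proof.
split; [exact rho1_even|].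
intros k Hk; apply (expdecay_weaken k 4); [lra|].
split; [exact rho1_continuous|exists 8; exact rho1_bound].
Qed.

Lemma rho1_le_8 (t : R) : Rabs (rho1 t) <= 8.
Proof.
apply Rle_trans with (1 := rho1_bound t).
rewrite -{2}(Rmult_1_r 8); apply Rmult_le_compat_l; [lra|].
rewrite -exp_0; apply exp_le_compat; generalize (Rabs_pos t); lra.
Qed.

Lemma continuous_shift (f : R -> R) (t : R) :
  (forall u, continuous f u) -> forall u, continuous (fun v => f (t - v)) u.
Proof.
intros Hf u; apply: continuous_comp; [|apply Hf].
apply: (continuous_minus (fun _ => t) (fun v => v)); [apply continuous_const|apply continuous_id].
Qed.

Lemma conv_integrand_expdecay (g : R -> R) (k t : R) :
  expdecay k g -> expdecay k (fun u => g u * rho1 (t - u)).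
Proof.
intros Hg.
destruct (expdecay_mult_bounded k 8 g (fun u => rho1 (t - u)) Hg
   (continuous_shift _ t rho1_continuous) (fun u => rho1_le_8 (t - u))) as [H1 [C HC]].
split.
  intros u; apply (continuous_ext (fun v => rho1 (t - v) * g v)); [intros v; apply Rmult_comm|apply H1].
exists C; intros u; rewrite Rmult_comm; apply HC.
Qed.

Lemma continuous_of_lipschitz (f : R -> R) (L : R) :
  (forall x y, Rabs (f y - f x) <= L * Rabs (y - x)) -> forall x, continuous f x.
Proof.
intros HL x.
apply filterlim_locally; intros eps.
assert (HL0 : 0 <= L).
  generalize (HL 0 1) (Rabs_pos (f 1 - f 0)); rewrite Rminus_0_r Rabs_R1; lra.
assert (Hd : 0 < eps / (L + 1)).
  apply Rdiv_lt_0_compat; [apply cond_pos|lra].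
exists (mkposreal _ Hd); intros y Hy.
change (Rabs (f y - f x) < eps); change (Rabs (y - x) < eps / (L + 1)) in Hy.
apply Rle_lt_trans with (1 := HL x y).
apply Rle_lt_trans with ((L + 1) * Rabs (y - x)).
  generalize (Rabs_pos (y - x)); nra.
apply Rmult_lt_compat_l with (r := L + 1) in Hy; [|lra].
replace ((L + 1) * (eps / (L + 1))) with (pos eps) in Hy by (field; lra).
exact Hy.
Qed.

Lemma conv_rho1_rholike (g : R -> R) : rholike g -> rholike (conv_rho1 g).
Proof.
intros [He Hg]; split.
- intros t; unfold conv_rho1.
  rewrite -(lineint_flip 1 (fun u => g u * rho1 (t - u))); [|lra|].
    apply lineint_ext; intros u; rewrite He; f_equal.
    rewrite -rho1_even; f_equal; ring.
  apply conv_integrand_expdecay, Hg; lra.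
- intros k Hk; split.
  + destruct (Hg 1) as [Hgc [C HC]]; [lra|].
    (* Continuity comes from the Lipschitz constant 16 of [rho1], integrated against
       [|g u| <= C exp (- |u|)]. *)
    apply continuous_of_lipschitz with (2 * (16 * C) / 1).
    intros x y; unfold conv_rho1.
    rewrite -(lineint_minus 1); [|lra|apply conv_integrand_expdecay, Hg; lra
                                    |apply conv_integrand_expdecay, Hg; lra].
    replace (2 * (16 * C) / 1 * Rabs (y - x)) with (2 * (16 * C * Rabs (y - x)) / 1) by field.
    apply lineint_bound; [lra| |].
    * intros u; apply: (continuous_minus (fun u => g u * rho1 (y - u)) (fun u => g u * rho1 (x - u)));
      apply conv_integrand_expdecay with 1; apply Hg; lra.
    * intros u; rewrite -Rmult_minus_distr_l Rabs_mult.
      assert (H := rho1_lipschitz (x - u) (y - u)).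
      replace (y - u - (x - u)) with (y - x) in H by ring.
      apply Rle_trans with (C * exp (- (1 * Rabs u)) * (16 * Rabs (y - x))).
        apply Rmult_le_compat; auto using Rabs_pos.
      apply Req_le; ring.
  (* The midpoint rate splits as [k + (4 - k) / 2]: by the triangle inequality [k] yields
     [exp (- k |t|)], and the rest keeps the integral in [u] finite. *)
  + destruct (Hg ((k + 4) / 2)) as [Hgc [C HC]]; [lra|].
    exists (2 * (8 * C) / ((4 - k) / 2)); intros t.
    replace (2 * (8 * C) / ((4 - k) / 2) * exp (- (k * Rabs t)))
      with (2 * (8 * C * exp (- (k * Rabs t))) / ((4 - k) / 2)) by (field; lra).
    apply lineint_bound; [lra| |].
      apply conv_integrand_expdecay with 1; apply Hg; lra.
    intros u; rewrite Rabs_mult.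
    apply Rle_trans with (C * exp (- ((k + 4) / 2 * Rabs u)) * (8 * exp (- (4 * Rabs (t - u))))).
      apply Rmult_le_compat; auto using Rabs_pos, rho1_bound.
    assert (HC0 : 0 <= C).
      generalize (HC 0) (Rabs_pos (g 0)); rewrite Rabs_R0 Rmult_0_r Ropp_0 exp_0; lra.
    replace (C * exp (- ((k + 4) / 2 * Rabs u)) * (8 * exp (- (4 * Rabs (t - u)))))
      with (8 * C * exp (- ((k + 4) / 2 * Rabs u) + - (4 * Rabs (t - u))))
      by (rewrite exp_plus; ring).
    rewrite !Rmult_assoc -exp_plus -!Rmult_assoc.
    apply Rmult_le_compat_l; [lra|]; apply exp_le_compat.
    assert (H := Rabs_triang u (t - u)); replace (u + (t - u)) with t in H by ring.
    generalize (Rabs_pos (t - u)) (Rabs_pos u); nra.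
Qed.

Lemma rho_rholike (l : nat) : rholike (rho l).
Proof.
unfold rho; induction (l - 1)%nat as [|k IH].
- exact rho1_rholike.
- exact (conv_rho1_rholike _ IH).
Qed.

Lemma rho_succ (l : nat) : (1 <= l)%nat -> rho (S l) = conv_rho1 (rho l).
Proof. intros Hl; unfold rho; now replace (S l - 1)%nat with (S (l - 1)) by lia. Qed.

(** * A holomorphic function on a strip *)

Lemma is_derive_mult_R (f g : R -> R) (x df dg : R) :
  is_derive f x df -> is_derive g x dg ->
  is_derive (fun y => f y * g y) x (df * g x + f x * dg).
Proof. intros Hf Hg; apply: (is_derive_mult f g x df dg Hf Hg); intros; apply Rmult_comm. Qed.

Lemma is_derive_eq (f : R -> R) (x a b : R) : is_derive f x a -> a = b -> is_derive f x b.
Proof. now intros H <-. Qed.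

Lemma MVT_closed (f df : R -> R) (a b : R) : a <= b ->
  (forall x, a <= x <= b -> is_derive f x (df x)) ->
  exists c, a <= c <= b /\ f b - f a = df c * (b - a).
Proof.
intros Hab Hd.
destruct (MVT_gen f a b df) as [c [Hc E]]; rewrite ?Rmin_left ?Rmax_right; try easy.
- intros x Hx; apply Hd; lra.
- intros x Hx; apply derivable_continuous_pt, ex_derive_Reals_0; eexists; now apply Hd.
- exists c; rewrite Rmin_left ?Rmax_right // in Hc.
Qed.

(* With [z = y + i t]: [csc2_den = 2 |sin (PI z)|^2], and [csc2_re], [csc2_im] are the real and
   imaginary parts of [1 / sin^2 (PI z) = 2 / (1 - cos (2 PI z))]; [csc2_re'], [csc2_im'] are
   those of its complex derivative, obtained by multiplying with [- 2 PI cot (PI z)]. *)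
Definition csc2_den (y t : R) : R := cosh (2 * PI * t) - cos (2 * PI * y).
Definition csc2_re (y t : R) : R :=
  2 * (1 - cos (2 * PI * y) * cosh (2 * PI * t)) / csc2_den y t ^ 2.
Definition csc2_im (y t : R) : R :=
  - (2 * sin (2 * PI * y) * sinh (2 * PI * t)) / csc2_den y t ^ 2.
Definition csc2_re' (y t : R) : R :=
  - (2 * PI) * (sin (2 * PI * y) * csc2_re y t + sinh (2 * PI * t) * csc2_im y t) / csc2_den y t.
Definition csc2_im' (y t : R) : R :=
  - (2 * PI) * (sin (2 * PI * y) * csc2_im y t - sinh (2 * PI * t) * csc2_re y t) / csc2_den y t.

Lemma cosh2_sinh2 (x : R) : cosh x ^ 2 = 1 + sinh x ^ 2.
Proof.
assert (H : exp x * exp (- x) = 1) by (rewrite -exp_plus Rplus_opp_r; apply exp_0).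
unfold cosh, sinh; nra.
Qed.

Lemma cosh_ge_quadratic (x : R) : 1 + x ^ 2 / 2 <= cosh x.
Proof.
assert (H : forall y, 0 <= y -> 1 + y ^ 2 / 2 <= cosh y).
  intros y Hy.
  assert (Hs : forall u, 0 <= u -> u <= sinh u).
    intros u Hu.
    destruct (MVT_closed (fun v => sinh v - v) (fun v => cosh v - 1) 0 u Hu) as [c [_ Hc]].
    - intros v _; auto_derive; [easy|ring].
    - generalize (cosh_ge_1 c); rewrite sinh_0 in Hc; nra.
  destruct (MVT_closed (fun v => cosh v - v ^ 2 / 2) (fun v => sinh v - v) 0 y Hy)
    as [c [Hc Hc']].
  - intros v _; auto_derive; [easy|simpl; field].
  - generalize (Hs c (proj1 Hc)); rewrite cosh_0 in Hc'; nra.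
destruct (Rle_dec 0 x) as [Hx|Hx]; [auto|].
replace (x ^ 2) with ((- x) ^ 2) by ring.
replace (cosh x) with (cosh (- x)) by (unfold cosh; rewrite Ropp_involutive; lra).
apply H; lra.
Qed.

Lemma csc2_den_pos (y t : R) : 0 < t -> 0 < csc2_den y t.
Proof.
intros Ht; unfold csc2_den.
assert (H := cosh_ge_quadratic (2 * PI * t)); assert (HP := PI_RGT_0).
assert (0 < (2 * PI * t) ^ 2) by (apply pow_lt; nra).
generalize (COS_bound (2 * PI * y)); lra.
Qed.

(** The Cauchy-Riemann equations, in the form [d/dt = i d/dy]. *)
Lemma csc2_holomorphic (y t : R) : 0 < t ->
  is_derive (fun v => csc2_re v t) y (csc2_re' y t) /\
  is_derive (fun v => csc2_im v t) y (csc2_im' y t) /\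
  is_derive (fun v => csc2_re y v) t (- csc2_im' y t) /\
  is_derive (fun v => csc2_im y v) t (csc2_re' y t).
Proof.
intros Ht; assert (HD := csc2_den_pos y t Ht).
assert (Hsc := sin2_cos2 (2 * PI * y)); assert (Hch := cosh2_sinh2 (2 * PI * t)).
unfold csc2_re', csc2_im', csc2_re, csc2_im, csc2_den, Rsqr in *.
split; [|split; [|split]]; (auto_derive; [apply Rgt_not_eq; nra|]);
  (* Once the four functions are made opaque, each equation is a rational identity modulo
     [X ^ 2 = 1 - P ^ 2] and [Y ^ 2 = Q ^ 2 - 1]. *)
  set (X := sin (2 * PI * y)) in *; set (P := cos (2 * PI * y)) in *;
  set (Y := sinh (2 * PI * t)) in *; set (Q := cosh (2 * PI * t)) in *;
  assert (HX : X ^ 2 = 1 - P ^ 2) by (simpl; lra); assert (HY : Y ^ 2 = Q ^ 2 - 1) by lra;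
  clearbody X P Y Q; (field_simplify_eq; [|apply Rgt_not_eq; nra]); ring [HX HY].
Qed.


Definition num_re (s y t : R) : R := sinh (s * y) * cos (s * t) - s * y.
Definition num_im (s y t : R) : R := cosh (s * y) * sin (s * t) - s * t.
Definition num_re' (s y t : R) : R := s * cosh (s * y) * cos (s * t) - s.
Definition num_im' (s y t : R) : R := s * sinh (s * y) * sin (s * t).

(* Real and imaginary part of [(sinh (s z) - s z) / sin^2 (PI z)] at [z = y + i t]; subtracting
   [s z] makes the singularity at [0] removable. *)
Definition kern_re (s y t : R) : R :=
  num_re s y t * csc2_re y t - num_im s y t * csc2_im y t.
Definition kern_im (s y t : R) : R :=
  num_re s y t * csc2_im y t + num_im s y t * csc2_re y t.
Definition kern_re' (s y t : R) : R :=
  num_re' s y t * csc2_re y t - num_im' s y t * csc2_im y t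
  + (num_re s y t * csc2_re' y t - num_im s y t * csc2_im' y t).

Lemma kern_re_derive_y (s y t : R) : 0 < t ->
  is_derive (fun v => kern_re s v t) y (kern_re' s y t).
Proof.
intros Ht; destruct (csc2_holomorphic y t Ht) as [H1 [H2 _]].
assert (H3 : is_derive (fun v => num_re s v t) y (num_re' s y t)).
  unfold num_re, num_re'; auto_derive; [easy|ring].
assert (H4 : is_derive (fun v => num_im s v t) y (num_im' s y t)).
  unfold num_im, num_im'; auto_derive; [easy|ring].
assert (H5 := is_derive_minus _ _ _ _ _ (is_derive_mult_R _ _ _ _ _ H3 H1)
                (is_derive_mult_R _ _ _ _ _ H4 H2)).
apply: is_derive_eq H5 _.
unfold kern_re', minus, plus, opp; simpl; ring.
Qed.

(** The [t]-derivative of the imaginary part is the same [kern_re'] as the [y]-derivative of the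
    real part, which makes the next integral exact. *)
Lemma kern_derive_t (s y t : R) : 0 < t ->
  is_derive (fun v => kern_im s y v) t (kern_re' s y t) /\ ex_derive (fun v => kern_re s y v) t.
Proof.
intros Ht; destruct (csc2_holomorphic y t Ht) as [_ [_ [H1 H2]]].
assert (H3 : is_derive (fun v => num_re s y v) t (- num_im' s y t)).
  unfold num_re, num_im'; auto_derive; [easy|ring].
assert (H4 : is_derive (fun v => num_im s y v) t (num_re' s y t)).
  unfold num_im, num_re'; auto_derive; [easy|ring].
split.
- assert (H5 := is_derive_plus _ _ _ _ _ (is_derive_mult_R _ _ _ _ _ H3 H2)
                (is_derive_mult_R _ _ _ _ _ H4 H1)).
  apply: is_derive_eq H5 _.
  unfold kern_re', minus, plus, opp; simpl; ring.
- eexists; exact (is_derive_minus _ _ _ _ _ (is_derive_mult_R _ _ _ _ _ H3 H1)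
                (is_derive_mult_R _ _ _ _ _ H4 H2)).
Qed.

Lemma continuity_pt_sinh (x : R) : continuity_pt sinh x.
Proof. apply derivable_continuous_pt; eexists; apply derivable_pt_lim_sinh. Qed.

Lemma continuity_pt_cosh (x : R) : continuity_pt cosh x.
Proof. apply derivable_continuous_pt; eexists; apply derivable_pt_lim_cosh. Qed.

Lemma continuity_2d_scal_fst (f : R -> R) (c x y : R) :
  continuity f -> continuity_2d_pt (fun u _ => f (c * u)) x y.
Proof.
intros Hf; apply continuity_1d_2d_pt_comp; [apply Hf|].
apply continuity_2d_pt_mult; [apply continuity_2d_pt_const|apply continuity_2d_pt_id1].
Qed.

Lemma continuity_2d_scal_snd (f : R -> R) (c x y : R) :
  continuity f -> continuity_2d_pt (fun _ v => f (c * v)) x y.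
Proof.
intros Hf; apply continuity_1d_2d_pt_comp; [apply Hf|].
apply continuity_2d_pt_mult; [apply continuity_2d_pt_const|apply continuity_2d_pt_id2].
Qed.

Lemma kern_re'_continuity_2d (s y t : R) : 0 < t ->
  continuity_2d_pt (fun u v => kern_re' s u v) y t.
Proof.
intros Ht; assert (HD := csc2_den_pos y t Ht).
assert (Cden : continuity_2d_pt (fun u v => / csc2_den u v) y t).
  apply continuity_2d_pt_inv; [|lra].
  apply continuity_2d_pt_minus.
    apply continuity_2d_scal_snd; exact continuity_pt_cosh.
  apply continuity_2d_scal_fst; exact continuity_cos.
assert (Cden2 : continuity_2d_pt (fun u v => / csc2_den u v ^ 2) y t).
  apply (continuity_2d_pt_ext (fun u v => / csc2_den u v * / csc2_den u v)).
    intros u v; rewrite -Rinv_mult; f_equal; ring.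
  now apply continuity_2d_pt_mult.
unfold kern_re', csc2_re', csc2_im', csc2_re, csc2_im, num_re, num_im, num_re', num_im', Rdiv.
repeat first [exact Cden2|exact Cden
  |apply (continuity_2d_scal_fst sin _ _ _ continuity_sin)
  |apply (continuity_2d_scal_fst cos _ _ _ continuity_cos)
  |apply (continuity_2d_scal_snd sin _ _ _ continuity_sin)
  |apply (continuity_2d_scal_snd cos _ _ _ continuity_cos)
  |apply (continuity_2d_scal_fst sinh _ _ _ continuity_pt_sinh)
  |apply (continuity_2d_scal_fst cosh _ _ _ continuity_pt_cosh)
  |apply (continuity_2d_scal_snd sinh _ _ _ continuity_pt_sinh)
  |apply (continuity_2d_scal_snd cosh _ _ _ continuity_pt_cosh)
  |apply continuity_2d_pt_plus|apply continuity_2d_pt_minus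
  |apply continuity_2d_pt_opp|apply continuity_2d_pt_mult|apply continuity_2d_pt_const
  |apply continuity_2d_pt_id1|apply continuity_2d_pt_id2].
Qed.

Lemma continuity_2d_section (f : R -> R -> R) (x y : R) :
  continuity_2d_pt f x y -> continuous (f x) y.
Proof.
intros H; apply filterlim_locally; intros eps.
destruct (H eps) as [d Hd]; exists d; intros v Hv.
apply Hd; [rewrite Rminus_diag Rabs_R0; apply cond_pos|exact Hv].
Qed.

(** Cauchy's theorem in differential form: under the integral sign the [y]-derivative of [kern_re]
    is the [t]-derivative of [kern_im], so only the ends remain. *)
Lemma kern_re_RInt_derive (s e r y : R) : 0 < e <= r ->
  is_derive (fun v => RInt (fun t => kern_re s v t) e r) y (kern_im s y r - kern_im s y e).
Proof.
intros Her.
assert (Hd : forall u v, 0 < v -> Derive (fun z => kern_re s z v) u = kern_re' s u v).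
  intros u v Hv; apply is_derive_unique; now apply kern_re_derive_y.
apply is_derive_eq with (RInt (fun t => Derive (fun u => kern_re s u t) y) e r).
- apply (is_derive_RInt_param (fun v t => kern_re s v t)).
  + apply filter_forall; intros u t; rewrite Rmin_left ?Rmax_right; try easy; intros Ht.
    eexists; apply kern_re_derive_y; lra.
  + intros t; rewrite Rmin_left ?Rmax_right; try easy; intros Ht.
    apply continuity_2d_pt_ext_loc with (fun u v => kern_re' s u v).
      assert (Ht0 : 0 < t) by lra.
      exists (mkposreal t Ht0); intros u v _ Hv; simpl in Hv.
      symmetry; apply Hd; apply Rabs_def2 in Hv; lra.
    apply kern_re'_continuity_2d; lra.
  + apply filter_forall; intros u; apply: ex_RInt_continuous; intros t.
    rewrite Rmin_left ?Rmax_right; try easy; intros Ht.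
    apply: ex_derive_continuous; apply kern_derive_t; lra.
- rewrite (RInt_ext _ (fun t => kern_re' s y t)).
    apply is_RInt_unique.
    apply: (is_RInt_derive (fun t => kern_im s y t)); intros t;
      rewrite Rmin_left ?Rmax_right; try easy; intros Ht.
    + apply kern_derive_t; lra.
    + apply (continuity_2d_section (kern_re' s)); apply kern_re'_continuity_2d; lra.
  intros t; rewrite Rmin_left ?Rmax_right; try easy; intros Ht; apply Hd; lra.
Qed.

(** * Elementary inequalities, and bounds on the kernel in the strip *)

Lemma sin_le_id (x : R) : 0 <= x -> sin x <= x.
Proof.
intros Hx; destruct (MVT_closed sin cos 0 x Hx) as [c [_ E]].
  intros u _; auto_derive; [easy|ring].
rewrite sin_0 in E; generalize (COS_bound c); nra.
Qed.

Lemma one_minus_cos_bound (x : R) : 0 <= x -> 0 <= 1 - cos x <= x ^ 2.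
Proof.
intros Hx; split; [generalize (COS_bound x); lra|].
destruct (MVT_closed cos (fun u => - sin u) 0 x Hx) as [c [Hc E]].
  intros u _; auto_derive; [easy|ring].
rewrite cos_0 in E; generalize (sin_le_id c (proj1 Hc)); nra.
Qed.

Lemma id_minus_sin_bound (x : R) : 0 <= x -> 0 <= x - sin x <= x ^ 3.
Proof.
intros Hx; split; [generalize (sin_le_id x Hx); lra|].
destruct (MVT_closed sin cos 0 x Hx) as [c [Hc E]].
  intros u _; auto_derive; [easy|ring].
rewrite sin_0 in E; generalize (one_minus_cos_bound c (proj1 Hc)).
intros [_ H]; assert (c ^ 2 <= x ^ 2) by (simpl; nra); simpl in *; nra.
Qed.

Lemma sinh_nonneg (x : R) : 0 <= x -> 0 <= sinh x.
Proof.
intros Hx; unfold sinh; assert (H := exp_le_compat (- x) x); lra.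
Qed.

Lemma cosh_increasing (x y : R) : 0 <= x <= y -> cosh x <= cosh y.
Proof.
intros Hxy; destruct (MVT_closed cosh sinh x y) as [c [Hc E]]; [lra| |].
  intros u _; auto_derive; [easy|ring].
assert (H := sinh_nonneg c); nra.
Qed.

Lemma sinh_bound (x : R) : 0 <= x -> 0 <= sinh x <= x * cosh x.
Proof.
intros Hx; split; [now apply sinh_nonneg|].
destruct (MVT_closed sinh cosh 0 x Hx) as [c [Hc E]].
  intros u _; auto_derive; [easy|ring].
rewrite sinh_0 in E; assert (H := cosh_increasing c x); nra.
Qed.

Lemma cosh_minus_one_bound (x : R) : 0 <= x -> 0 <= cosh x - 1 <= x ^ 2 * cosh x.
Proof.
intros Hx; split; [generalize (cosh_ge_1 x); lra|].
destruct (MVT_closed cosh sinh 0 x Hx) as [c [Hc E]].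
  intros u _; auto_derive; [easy|ring].
rewrite cosh_0 in E; assert (H := cosh_increasing c x); assert (H' := sinh_bound c).
assert (sinh c <= x * cosh x).
  apply Rle_trans with (1 := proj2 (H' (proj1 Hc))).
  apply Rmult_le_compat; try lra; generalize (cosh_ge_1 c); lra.
simpl; nra.
Qed.

Lemma sinh_minus_id_bound (x : R) : 0 <= x -> 0 <= sinh x - x <= x ^ 3 * cosh x.
Proof.
intros Hx.
destruct (MVT_closed sinh cosh 0 x Hx) as [c [Hc E]].
  intros u _; auto_derive; [easy|ring].
rewrite sinh_0 in E; assert (H := cosh_increasing c x); assert (H' := cosh_minus_one_bound c).
generalize (cosh_ge_1 c); intros H1.
assert (cosh c - 1 <= x ^ 2 * cosh x).
  apply Rle_trans with (1 := proj2 (H' (proj1 Hc))).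
  apply Rmult_le_compat; try lra; simpl; nra.
split; [nra|simpl in *; nra].
Qed.

(* Half-angle: [sin x = 2 sin (x/2) cos (x/2)], and both [cos (x/2)] and the mean value
   [cos c = sin (x/2) / (x/2)] are at least [cos (PI/4)]. *)
Lemma half_le_sin (x : R) : 0 <= x <= PI / 2 -> x / 2 <= sin x.
Proof.
intros Hx; assert (HP := PI_RGT_0).
destruct (MVT_closed sin cos 0 (x / 2)) as [c [Hc E]]; [lra| |].
  intros u _; auto_derive; [easy|ring].
rewrite sin_0 in E.
assert (Hc4 : forall u, 0 <= u <= PI / 4 -> 0 < cos (PI / 4) <= cos u).
  intros u Hu; split; [apply cos_gt_0; lra|].
  apply cos_decr_1; lra.
assert (Hsq : cos (PI / 4) * cos (PI / 4) = 1 / 2).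
  generalize (sin2_cos2 (PI / 4)); rewrite sin_cos_PI4 /Rsqr; lra.
replace (sin x) with (2 * sin (x / 2) * cos (x / 2)).
  2: rewrite -sin_2a; f_equal; field.
destruct (Hc4 c) as [H1 H2]; [lra|]; destruct (Hc4 (x / 2)) as [_ H3]; [lra|].
assert (1 / 2 <= cos c * cos (x / 2)) by (rewrite -Hsq; apply Rmult_le_compat; lra).
replace (sin (x / 2)) with (cos c * (x / 2)) by lra.
nra.
Qed.

(** Splits as [cosh (2 PI t) - 1 >= 2 t ^ 2] and [1 - cos (2 PI y) = 2 sin ^ 2 (PI y) >= 2 y ^ 2];
    [y <= 1/2] stays away from the pole at 1. *)
Lemma csc2_den_ge (y t : R) : 0 <= y <= 1 / 2 -> 2 * (y ^ 2 + t ^ 2) <= csc2_den y t.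
Proof.
intros Hy; unfold csc2_den; assert (HP := PI_RGT_0); assert (HP3 := PI2_3_2).
assert (H1 := cosh_ge_quadratic (2 * PI * t)).
assert (H2 : y <= sin (PI * y)).
  apply Rle_trans with (PI * y / 2); [nra|apply half_le_sin; nra].
replace (2 * PI * y) with (2 * (PI * y)) by ring.
rewrite cos_2a_sin.
assert (y ^ 2 <= sin (PI * y) * sin (PI * y)) by (simpl; nra).
assert (4 * t ^ 2 <= (2 * PI * t) ^ 2).
  replace ((2 * PI * t) ^ 2) with ((2 * PI) ^ 2 * t ^ 2) by ring.
  apply Rmult_le_compat_r; [apply pow2_ge_0|nra].
lra.
Qed.

(** [2 / csc2_den] is the modulus of [1 / sin^2 (PI z)]: identity [E] computes the sum of the
    squares of the two numerators without their factor 2. *)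
Lemma csc2_bounds (y t : R) : 0 < t ->
  Rabs (csc2_re y t) <= 2 / csc2_den y t /\ Rabs (csc2_im y t) <= 2 / csc2_den y t.
Proof.
intros Ht; assert (HD := csc2_den_pos y t Ht).
unfold csc2_re, csc2_im.
set (X := sin (2 * PI * y)); set (P := cos (2 * PI * y)).
set (Y := sinh (2 * PI * t)); set (Q := cosh (2 * PI * t)).
assert (HX : X ^ 2 = 1 - P ^ 2).
  generalize (sin2_cos2 (2 * PI * y)); fold X P; unfold Rsqr; simpl; lra.
assert (HY : Y ^ 2 = Q ^ 2 - 1) by (unfold Y, Q; rewrite cosh2_sinh2; ring).
assert (ED : csc2_den y t = Q - P) by easy.
assert (E : (1 - P * Q) ^ 2 + (X * Y) ^ 2 = csc2_den y t ^ 2).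
  replace ((X * Y) ^ 2) with (X ^ 2 * Y ^ 2) by ring; rewrite HX HY ED; ring.
assert (Hgen : forall a b, a ^ 2 + b ^ 2 = csc2_den y t ^ 2 ->
    Rabs (2 * a / csc2_den y t ^ 2) <= 2 / csc2_den y t).
  intros a b Eab; rewrite Rabs_div; [|apply pow_nonzero; lra].
  rewrite Rabs_mult (Rabs_pos_eq 2); [|lra]; rewrite (Rabs_pos_eq (_ ^ 2)); [|nra].
  assert (Rabs a <= csc2_den y t).
    apply Rabs_le; generalize (pow2_ge_0 b); nra.
  apply Rmult_le_reg_r with (csc2_den y t ^ 2); [nra|].
  field_simplify; [nra|lra|lra].
split; [now apply (Hgen _ (X * Y))|].
replace (- (2 * X * Y)) with (2 * (- (X * Y))) by ring.
apply (Hgen _ (1 - P * Q)); rewrite -E; ring.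
Qed.

(** [sinh w - w] is [O(|w|^3)]. The separate factors [y] and [t] record that the real part vanishes
    on the imaginary axis and the imaginary part on the real one; a bound on the modulus alone would
    lose this. *)
Lemma num_bounds (s y t : R) : 0 < s -> 0 <= y <= 1 / 2 -> 0 <= t ->
  Rabs (num_re s y t) <= s ^ 3 * cosh s * (y * (y ^ 2 + t ^ 2)) /\
  Rabs (num_im s y t) <= s ^ 3 * cosh s * (t * (y ^ 2 + t ^ 2)).
Proof.
intros Hs Hy Ht.
assert (Hsy : 0 <= s * y) by nra; assert (Hst : 0 <= s * t) by nra.
assert (HK : cosh (s * y) <= cosh s) by (apply cosh_increasing; nra).
assert (HK1 := cosh_ge_1 s).
destruct (sinh_minus_id_bound _ Hsy) as [A1 A2].
destruct (cosh_minus_one_bound _ Hsy) as [B1 B2].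
destruct (one_minus_cos_bound _ Hst) as [C1 C2].
destruct (id_minus_sin_bound _ Hst) as [D1 D2].
assert (A3 : sinh (s * y) - s * y <= s ^ 3 * cosh s * y ^ 3).
  apply Rle_trans with (1 := A2).
  replace (s ^ 3 * cosh s * y ^ 3) with ((s * y) ^ 3 * cosh s) by ring.
  apply Rmult_le_compat_l; [now apply pow_le|easy].
assert (B3 : cosh (s * y) - 1 <= s ^ 2 * cosh s * y ^ 2).
  apply Rle_trans with (1 := B2).
  replace (s ^ 2 * cosh s * y ^ 2) with ((s * y) ^ 2 * cosh s) by ring.
  apply Rmult_le_compat_l; [now apply pow_le|easy].
split.
- unfold num_re.
  replace (sinh (s * y) * cos (s * t) - s * y) with
    ((sinh (s * y) - s * y) * cos (s * t) + - (s * y * (1 - cos (s * t)))) by ring.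
  apply Rle_trans with (1 := Rabs_triang _ _).
  rewrite Rabs_Ropp !Rabs_mult (Rabs_pos_eq _ A1) (Rabs_pos_eq _ C1).
  rewrite -Rabs_mult (Rabs_pos_eq _ Hsy).
  assert (Hc : Rabs (cos (s * t)) <= 1) by (apply Rabs_le, COS_bound).
  assert (E1 : (sinh (s * y) - s * y) * Rabs (cos (s * t)) <= s ^ 3 * cosh s * y ^ 3).
    rewrite -(Rmult_1_r (s ^ 3 * cosh s * y ^ 3)).
    apply Rmult_le_compat; auto using Rabs_pos.
  assert (E2 : s * y * (1 - cos (s * t)) <= s * y * (s * t) ^ 2).
    now apply Rmult_le_compat_l.
  assert (E3 : s * y * (s * t) ^ 2 <= s ^ 3 * cosh s * (y * t ^ 2)).
    replace (s * y * (s * t) ^ 2) with (s ^ 3 * (y * t ^ 2) * 1) by ring.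
    replace (s ^ 3 * cosh s * (y * t ^ 2)) with (s ^ 3 * (y * t ^ 2) * cosh s) by ring.
    apply Rmult_le_compat_l; [|easy].
    apply Rmult_le_pos; [apply pow_le; lra|apply Rmult_le_pos; [lra|apply pow2_ge_0]].
  replace (s ^ 3 * cosh s * (y * (y ^ 2 + t ^ 2))) with
    (s ^ 3 * cosh s * y ^ 3 + s ^ 3 * cosh s * (y * t ^ 2)) by ring.
  lra.
- unfold num_im.
  replace (cosh (s * y) * sin (s * t) - s * t) with
    ((cosh (s * y) - 1) * sin (s * t) + - (s * t - sin (s * t))) by ring.
  apply Rle_trans with (1 := Rabs_triang _ _).
  rewrite Rabs_Ropp Rabs_mult (Rabs_pos_eq _ B1) (Rabs_pos_eq _ D1).
  assert (Hsn : Rabs (sin (s * t)) <= s * t).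
    apply Rabs_le; split; [|lra].
    destruct (Rle_dec (s * t) 1) as [H|H].
      generalize (sin_ge_0 (s * t) Hst); assert (H4 := PI2_3_2); lra.
    generalize (SIN_bound (s * t)); lra.
  assert (E1 : (cosh (s * y) - 1) * Rabs (sin (s * t)) <= s ^ 2 * cosh s * y ^ 2 * (s * t)).
    apply Rmult_le_compat; auto using Rabs_pos.
  assert (E3 : (s * t) ^ 3 <= s ^ 3 * cosh s * (t ^ 3)).
    replace ((s * t) ^ 3) with ((s * t) ^ 3 * 1) by ring.
    replace (s ^ 3 * cosh s * t ^ 3) with ((s * t) ^ 3 * cosh s) by ring.
    apply Rmult_le_compat_l; [now apply pow_le|easy].
  replace (s ^ 3 * cosh s * (t * (y ^ 2 + t ^ 2))) with
    (s ^ 2 * cosh s * y ^ 2 * (s * t) + s ^ 3 * cosh s * t ^ 3) by ring.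
  lra.
Qed.

(** The factor [y * t] reflects that [1 / sin^2 (PI z)] is real on both axes. *)
Lemma csc2_im_near (y t : R) : 0 <= y <= 1 / 2 -> 0 < t <= 1 ->
  Rabs (csc2_im y t) <= 2 * (2 * PI) ^ 2 * cosh (2 * PI) * (y * t) / csc2_den y t ^ 2.
Proof.
intros Hy Ht; assert (HD := csc2_den_pos y t (proj1 Ht)); assert (HP := PI_RGT_0).
unfold csc2_im, Rdiv; rewrite Rabs_mult Rabs_Ropp Rabs_inv (Rabs_pos_eq (_ ^ 2)); [|nra].
apply Rmult_le_compat_r; [apply Rlt_le, Rinv_0_lt_compat, pow_lt, HD|].
assert (H1 : Rabs (sin (2 * PI * y)) <= 2 * PI * y).
  rewrite Rabs_pos_eq; [apply sin_le_id; nra|apply sin_ge_0; nra].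
assert (H2 : Rabs (sinh (2 * PI * t)) <= 2 * PI * t * cosh (2 * PI)).
  destruct (sinh_bound (2 * PI * t)) as [A B]; [nra|].
  rewrite Rabs_pos_eq; [|easy].
  apply Rle_trans with (1 := B); apply Rmult_le_compat_l; [nra|].
  apply cosh_increasing; nra.
rewrite (Rabs_mult (2 * _)) (Rabs_mult 2) (Rabs_pos_eq 2); [|lra].
replace (2 * (2 * PI) ^ 2 * cosh (2 * PI) * (y * t)) with
  (2 * (2 * PI * y) * (2 * PI * t * cosh (2 * PI))) by ring.
generalize (Rabs_pos (sin (2 * PI * y))) (Rabs_pos (sinh (2 * PI * t))); intros.
apply Rmult_le_compat; lra.
Qed.

Definition kern_near_const (s : R) : R :=
  s ^ 3 * cosh s * (2 * (2 * PI) ^ 2 * cosh (2 * PI) / 4) + s ^ 3 * cosh s.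

(** With [r = |z|^2], the first product is of order [(y r) (y t) / r^2 <= t] and the second of order
    [(t r) / r = t]. Uniformity in [y] is the point: the whole lower edge, corner at the pole
    included, disappears as [t -> 0]. *)
Lemma kern_im_near (s y t : R) : 0 < s -> 0 <= y <= 1 / 2 -> 0 < t <= 1 ->
  Rabs (kern_im s y t) <= kern_near_const s * t.
Proof.
intros Hs Hy Ht.
destruct (num_bounds s y t Hs Hy) as [N1 N2]; [lra|].
assert (P2 := csc2_im_near y t Hy Ht).
destruct (csc2_bounds y t) as [P1 _]; [easy|].
assert (HD := csc2_den_ge y t Hy); assert (HK := cosh_ge_1 s); assert (HK2 := cosh_ge_1 (2 * PI)).
assert (Hr : 0 < y ^ 2 + t ^ 2) by nra.
set (r := y ^ 2 + t ^ 2) in *; set (D := csc2_den y t) in *.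
assert (HA : 0 <= s ^ 3 * cosh s) by (apply Rmult_le_pos; [apply pow_le; lra|lra]).
set (A := s ^ 3 * cosh s) in *.
assert (HB : 0 <= 2 * (2 * PI) ^ 2 * cosh (2 * PI)).
  apply Rmult_le_pos; [|lra]; generalize (pow2_ge_0 (2 * PI)); lra.
unfold kern_near_const; fold A.
set (B := 2 * (2 * PI) ^ 2 * cosh (2 * PI)) in *.
assert (ID : / D <= / (2 * r)) by (apply Rinv_le_contravar; lra).
assert (ID0 : 0 < / D) by (apply Rinv_0_lt_compat; lra).
unfold kern_im; apply Rle_trans with (1 := Rabs_triang _ _).
rewrite (Rabs_mult (num_re _ _ _)) (Rabs_mult (num_im _ _ _)).
assert (T1 : Rabs (num_re s y t) * Rabs (csc2_im y t) <= A * (B / 4) * t).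
  apply Rle_trans with (A * (y * r) * (B * (y * t) / D ^ 2)).
    apply Rmult_le_compat; auto using Rabs_pos.
  apply Rle_trans with (A * (y * r) * (B * (y * t) * (/ (2 * r) * / (2 * r)))).
    apply Rmult_le_compat_l.
      apply Rmult_le_pos; [easy|nra].
    apply Rmult_le_compat_l; [apply Rmult_le_pos; [easy|nra]|].
    replace (/ D ^ 2) with (/ D * / D) by (rewrite -Rinv_mult; f_equal; ring).
    apply Rmult_le_compat; lra.
  replace (A * (y * r) * (B * (y * t) * (/ (2 * r) * / (2 * r)))) with
    (A * (B / 4) * t * (y ^ 2 / r)) by (field; lra).
  rewrite -[X in _ <= X]Rmult_1_r.
  apply Rmult_le_compat_l.
    apply Rmult_le_pos; [|lra]; apply Rmult_le_pos; lra.
  apply Rmult_le_reg_r with r; [easy|]; unfold Rdiv.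
  rewrite Rmult_assoc Rinv_l; [|lra].
  generalize (pow2_ge_0 t); unfold r; lra.
assert (T2 : Rabs (num_im s y t) * Rabs (csc2_re y t) <= A * t).
  apply Rle_trans with (A * (t * r) * (2 * / (2 * r))).
    apply Rmult_le_compat; auto using Rabs_pos.
    apply Rle_trans with (1 := P1); unfold Rdiv; apply Rmult_le_compat_l; lra.
  apply Req_le; field; lra.
lra.
Qed.

(** The quadratic lower bound on the denominator already beats the linear growth [O(t)] of the
    numerator, so the exponential decay of [1 / sin^2] is not called upon. *)
Lemma kern_im_far (s y t : R) : 0 < s -> 0 <= y <= 1 / 2 -> 1 <= t ->
  Rabs (kern_im s y t) <= 2 * (cosh s + s) / t.
Proof.
intros Hs Hy Ht.
destruct (csc2_bounds y t) as [P1 P2]; [lra|].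
assert (HD := csc2_den_ge y t Hy); assert (HK := cosh_ge_1 s).
assert (HK' : cosh (s * y) <= cosh s) by (apply cosh_increasing; nra).
assert (HC : 2 / csc2_den y t <= / t ^ 2).
  replace (/ t ^ 2) with (2 / (2 * t ^ 2)) by (field; lra).
  apply Rmult_le_compat_l; [lra|]; apply Rinv_le_contravar; nra.
assert (N1 : Rabs (num_re s y t) <= cosh s + s).
  unfold num_re, Rminus; apply Rle_trans with (1 := Rabs_triang _ _).
  rewrite Rabs_Ropp Rabs_mult (Rabs_pos_eq (s * y)); [|nra].
  assert (H1 := sinh_le_cosh (s * y)).
  assert (Hc : Rabs (cos (s * t)) <= 1) by (apply Rabs_le, COS_bound).
  generalize (Rabs_pos (cos (s * t))) (Rabs_pos (sinh (s * y))); nra.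
assert (N2 : Rabs (num_im s y t) <= cosh s + s * t).
  unfold num_im, Rminus; apply Rle_trans with (1 := Rabs_triang _ _).
  rewrite Rabs_Ropp Rabs_mult (Rabs_pos_eq (s * t)); [|nra].
  rewrite (Rabs_pos_eq (cosh _)); [|generalize (cosh_ge_1 (s * y)); lra].
  assert (Hc : Rabs (sin (s * t)) <= 1) by (apply Rabs_le, SIN_bound).
  generalize (Rabs_pos (sin (s * t))) (cosh_ge_1 (s * y)); nra.
unfold kern_im; apply Rle_trans with (1 := Rabs_triang _ _).
rewrite (Rabs_mult (num_re _ _ _)) (Rabs_mult (num_im _ _ _)).
apply Rle_trans with ((cosh s + s) * t * / t ^ 2 + (cosh s + s) * t * / t ^ 2).
  apply Rplus_le_compat; apply Rmult_le_compat; auto using Rabs_pos; nra.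
apply Req_le; field; lra.
Qed.

Lemma kern_re_left (s t : R) : 0 < t -> kern_re s 0 t = 0.
Proof.
intros _; unfold kern_re, num_re, csc2_im; rewrite !Rmult_0_r sinh_0 sin_0; unfold Rdiv; ring.
Qed.

Lemma kern_re_right (s t : R) : 0 < t ->
  kern_re s (1 / 2) t = (sinh (s / 2) * cos (s * t) - s / 2) / cosh (PI * t) ^ 2.
Proof.
intros Ht; unfold kern_re, num_re, csc2_im, csc2_re, csc2_den.
replace (2 * PI * (1 / 2)) with PI by field.
replace (s * (1 / 2)) with (s / 2) by field.
rewrite sin_PI cos_PI.
assert (E : cosh (2 * PI * t) = 2 * cosh (PI * t) ^ 2 - 1).
  unfold cosh.
  replace (exp (2 * PI * t)) with (exp (PI * t) * exp (PI * t)) by (rewrite -exp_plus; f_equal; ring).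
  replace (exp (- (2 * PI * t))) with (exp (- (PI * t)) * exp (- (PI * t)))
    by (rewrite -exp_plus; f_equal; ring).
  assert (H : exp (PI * t) * exp (- (PI * t)) = 1) by (rewrite -exp_plus Rplus_opp_r; apply exp_0).
  nra.
rewrite E; assert (H := cosh_ge_1 (PI * t)); field; split; nra.
Qed.

(** Mean value theorem across the strip: the integral is 0 at [y = 0], its [y]-derivative is the
    difference of the two edge values, and the final [/ 2] is the width of the strip. *)
Lemma kern_re_right_RInt_bound (s e r : R) : 0 < s -> 0 < e <= 1 -> 1 <= r ->
  Rabs (RInt (kern_re s (1 / 2)) e r) <= (kern_near_const s * e + 2 * (cosh s + s) / r) / 2.
Proof.
intros Hs He Hr.
destruct (MVT_closed (fun v => RInt (fun t => kern_re s v t) e r)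
  (fun y => kern_im s y r - kern_im s y e) 0 (1 / 2)) as [c [Hc E]].
- lra.
- intros y _; apply kern_re_RInt_derive; lra.
- rewrite (RInt_ext (kern_re s 0) (fun _ => 0)) in E.
    2: intros t; rewrite Rmin_left ?Rmax_right; try lra; intros Ht; apply kern_re_left; lra.
  rewrite RInt_const in E; unfold scal in E; simpl in E; unfold mult in E; simpl in E.
  rewrite Rmult_0_r !Rminus_0_r in E.
  change (RInt (kern_re s (1 / 2)) e r) with (RInt (fun t => kern_re s (1 / 2) t) e r).
  rewrite E Rabs_mult (Rabs_pos_eq (1 / 2)); [|lra].
  assert (H := Rabs_triang (kern_im s c r) (- kern_im s c e)).
  rewrite Rabs_Ropp in H.
  generalize (kern_im_near s c e Hs Hc He) (kern_im_far s c r Hs Hc Hr); unfold Rminus; lra.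
Qed.

Lemma halfline_rho1_recentered (s : R) : 0 < s ->
  halfline_lim (fun t => (sinh (s / 2) * cos (s * t) - s / 2) * rho1 t) 0.
Proof.
intros Hs; set (f := fun t => (sinh (s / 2) * cos (s * t) - s / 2) * rho1 t).
assert (Hf : forall u, continuous f u).
  intros u; apply: (continuous_mult _ rho1); [|apply rho1_continuous].
  apply: ex_derive_continuous; now auto_derive.
set (M := (Rabs (sinh (s / 2)) + s / 2) * 8).
assert (HM : forall u, Rabs (f u) <= M).
  intros u; unfold f, M; rewrite Rabs_mult.
  apply Rmult_le_compat; auto using Rabs_pos, rho1_le_8.
  apply Rle_trans with (1 := Rabs_triang _ _).
  rewrite Rabs_Ropp Rabs_mult (Rabs_pos_eq (s / 2)); [|lra].
  assert (Hc : Rabs (cos (s * u)) <= 1) by (apply Rabs_le, COS_bound).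
  generalize (Rabs_pos (sinh (s / 2))); nra.
(* The lower edge at height [e] is removed with [r] fixed: its cost is made smaller than an
   arbitrary [eps], which leaves the upper edge alone. *)
assert (HB : forall r, 1 <= r -> Rabs (RInt f 0 r) <= PI * (cosh s + s) / 2 / r).
  intros r Hr; apply le_epsilon; intros eps Heps.
  assert (HPI := PI_RGT_0).
  assert (HK : 0 <= kern_near_const s).
    generalize (kern_im_near s 0 1 Hs); intros H.
    assert (H' := Rabs_pos (kern_im s 0 1)); lra.
  assert (HM0 : 0 <= M) by (generalize (HM 0) (Rabs_pos (f 0)); lra).
  (* [T] collects the costs proportional to [e]: [M] for the omitted segment [[0, e]], the second
     term for the lower edge; [+ 1] makes it positive. *)
  set (T := M + PI / 2 * kern_near_const s / 2 + 1).
  assert (HT : 1 <= T) by (unfold T; assert (0 <= PI / 2 * kern_near_const s) by nra; lra).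
  set (e := Rmin 1 (eps / T)).
  assert (He : 0 < e <= 1).
    split; [apply Rmin_glb_lt; [lra|apply Rdiv_lt_0_compat; lra]|apply Rmin_l].
  assert (HeT : e * T <= eps).
    replace eps with (eps / T * T) at 1 by (field; lra).
    apply Rmult_le_compat_r; [lra|apply Rmin_r].
  rewrite (RInt_Chasles_R f 0 e r Hf).
  apply Rle_trans with (1 := Rabs_triang _ _).
  assert (H1 : Rabs (RInt f 0 e) <= (e - 0) * M).
    apply: (norm_RInt_le_const f 0 e); [lra|intros x _; apply HM|].
    apply: RInt_correct; now apply continuous_ex_RInt.
  assert (H2 : RInt f e r = PI / 2 * RInt (kern_re s (1 / 2)) e r).
    transitivity (RInt (fun t => scal (PI / 2) (kern_re s (1 / 2) t)) e r); last first.
      apply: (RInt_scal (kern_re s (1 / 2)) e r (PI / 2)).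
      apply: ex_RInt_continuous; intros t; rewrite Rmin_left ?Rmax_right; try lra; intros Ht.
      apply: ex_derive_continuous; apply kern_derive_t; lra.
    apply RInt_ext; intros t; rewrite Rmin_left ?Rmax_right; try lra; intros Ht.
    rewrite kern_re_right; [|lra]. unfold f, rho1, scal; simpl; unfold mult; simpl.
    field; generalize (cosh_ge_1 (PI * t)); lra.
  rewrite H2 Rabs_mult (Rabs_pos_eq (PI / 2)); [|lra].
  assert (H3 := kern_re_right_RInt_bound s e r Hs He Hr).
  assert (H4 : PI / 2 * Rabs (RInt (kern_re s (1 / 2)) e r) <=
    PI / 2 * ((kern_near_const s * e + 2 * (cosh s + s) / r) / 2)).
    apply Rmult_le_compat_l; lra.
  unfold T in HeT; unfold Rdiv in *; nra.
apply filterlim_locally; intros eps.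
set (A := PI * (cosh s + s) / 2) in *.
exists (Rmax 1 (A / eps)); intros x Hx.
assert (H1 := Rmax_l 1 (A / eps)); assert (H2 := Rmax_r 1 (A / eps)); assert (He := cond_pos eps).
change (Rabs (RInt f 0 x - 0) < eps); rewrite Rminus_0_r.
apply Rle_lt_trans with (1 := HB x ltac:(lra)).
apply Rmult_lt_reg_r with x; [lra|].
unfold Rdiv at 1; rewrite Rmult_assoc Rinv_l ?Rmult_1_r; [|lra].
apply Rmult_lt_reg_r with (/ eps); [now apply Rinv_0_lt_compat|].
replace (eps * x * / eps) with x by (field; lra); unfold Rdiv in H2; lra.
Qed.

(** * Cosine transforms *)

Lemma halfline_lim_exp_rate (f : R -> R) (L K : R) :
  (forall x, 0 <= x -> Rabs (RInt f 0 x - L) <= K * exp (- x)) -> halfline_lim f L.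
Proof.
intros H; apply filterlim_locally; intros eps.
destruct (exp_decay_small K 1 eps) as [M [HM0 HM]]; [lra|apply cond_pos|].
exists M; intros x Hx; change (Rabs (RInt f 0 x - L) < eps).
apply Rle_lt_trans with (1 := H x ltac:(lra)).
rewrite -[x in exp (- x)]Rmult_1_l; apply HM; lra.
Qed.

(** [tanh (PI x) / 2] is a primitive, and [1 - tanh y = exp (- y) / cosh y]. *)
Lemma halfline_rho1_mass : halfline_lim rho1 (1 / 2).
Proof.
apply halfline_lim_exp_rate with (1 / 2); intros x Hx.
assert (HP := PI_RGT_0); assert (HP3 := PI2_3_2).
assert (E : RInt rho1 0 x = sinh (PI * x) / cosh (PI * x) / 2).
  apply is_RInt_unique.
  replace (sinh (PI * x) / cosh (PI * x) / 2) with
    (minus (sinh (PI * x) / cosh (PI * x) / 2) (sinh (PI * 0) / cosh (PI * 0) / 2)).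
    apply: (is_RInt_derive (fun t => sinh (PI * t) / cosh (PI * t) / 2)).
      intros t _; assert (Hc := cosh_ge_1 (PI * t)).
      auto_derive; [lra|].
      unfold rho1; field_simplify_eq; [|lra].
      rewrite (cosh2_sinh2 (PI * t)); ring.
    intros t _; apply rho1_continuous.
  rewrite Rmult_0_r sinh_0; unfold minus, plus, opp; simpl; lra.
rewrite E; assert (Hc := cosh_ge_1 (PI * x)).
replace (sinh (PI * x) / cosh (PI * x) / 2 - 1 / 2) with
  (- (1 / 2 * (exp (- (PI * x)) / cosh (PI * x)))).
  2: assert (Es : sinh (PI * x) = cosh (PI * x) - exp (- (PI * x))) by (unfold sinh, cosh; lra);
     rewrite Es; field; lra.
rewrite Rabs_Ropp Rabs_pos_eq.
  apply Rmult_le_compat_l; [lra|].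
  apply Rle_trans with (exp (- (PI * x))); [|apply exp_le_compat; nra].
  apply Rmult_le_reg_r with (cosh (PI * x)); [lra|].
  unfold Rdiv; rewrite Rmult_assoc Rinv_l; [|lra].
  generalize (exp_pos (- (PI * x))); nra.
apply Rmult_le_pos; [lra|]; apply Rdiv_le_0_compat; [apply Rlt_le, exp_pos|lra].
Qed.

Definition cosint (g : R -> R) (s : R) : R := lineint (fun u => cos (s * u) * g u).

Lemma continuous_cos_scal (s u : R) : continuous (fun v => cos (s * v)) u.
Proof. apply: ex_derive_continuous; now auto_derive. Qed.

Lemma continuous_sin_scal (s u : R) : continuous (fun v => sin (s * v)) u.
Proof. apply: ex_derive_continuous; now auto_derive. Qed.

Lemma expdecay_cos (k s : R) (g : R -> R) :
  expdecay k g -> expdecay k (fun u => cos (s * u) * g u).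
Proof.
intros Hg; apply (expdecay_mult_bounded k 1 g (fun u => cos (s * u)) Hg).
- apply continuous_cos_scal.
- intros u; apply Rabs_le, COS_bound.
Qed.

Lemma cosint_halfline (k s : R) (g : R -> R) :
  0 < k -> expdecay k g -> (forall u, g (- u) = g u) ->
  halfline_lim (fun u => cos (s * u) * g u) (cosint g s / 2).
Proof.
intros Hk Hg He.
assert (Hc := expdecay_cos k s g Hg).
apply (halfline_lim_ext (fun u => / 2 * (cos (s * u) * g u + cos (s * - u) * g (- u)))).
  intros u; rewrite He Ropp_mult_distr_r_reverse cos_neg; field.
unfold Rdiv; rewrite Rmult_comm; apply halfline_lim_scal.
  apply (continuous_flip_plus (fun u => cos (s * u) * g u)), Hc.
now apply (expdecay_line_lim k (fun u => cos (s * u) * g u)).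
Qed.

Lemma rho1_expdecay : expdecay 1 rho1.
Proof. apply rho1_rholike; lra. Qed.

Lemma cosint_rho1_0 : cosint rho1 0 = 1.
Proof.
assert (H := cosint_halfline 1 0 rho1 Rlt_0_1 rho1_expdecay rho1_even).
assert (H' : halfline_lim rho1 (cosint rho1 0 / 2)).
  apply: halfline_lim_ext H; intros u; rewrite Rmult_0_l cos_0; ring.
assert (E := halfline_lim_unique _ _ _ H' halfline_rho1_mass); lra.
Qed.

Lemma sinh_neq_0 (x : R) : x <> 0 -> sinh x <> 0.
Proof.
assert (H : forall y, 0 < y -> 0 < sinh y).
  intros y Hy; generalize (exp_increasing (- y) y); unfold sinh; lra.
intros Hx; destruct (Rtotal_order x 0) as [H1|[H1|H1]]; [|easy|].
- assert (H2 := H (- x)); unfold sinh in *; rewrite Ropp_involutive in H2; lra.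
- generalize (H x H1); lra.
Qed.

(** For [s > 0] the vanishing limit reads [sinh (s / 2) * (cosint rho1 s / 2) = s / 2 * (1 / 2)];
    for [s < 0] both sides are even in [s]. *)
Lemma cosint_rho1 (s : R) : s <> 0 -> cosint rho1 s = s / 2 / sinh (s / 2).
Proof.
assert (Hpos : forall s, 0 < s -> cosint rho1 s = s / 2 / sinh (s / 2)).
  clear s; intros s Hs.
  assert (H1 := cosint_halfline 1 s rho1 Rlt_0_1 rho1_expdecay rho1_even).
  assert (H2 : halfline_lim (fun t => (sinh (s / 2) * cos (s * t) - s / 2) * rho1 t)
     (sinh (s / 2) * (cosint rho1 s / 2) + - (s / 2) * (1 / 2))).
    apply (halfline_lim_ext
      (fun t => sinh (s / 2) * (cos (s * t) * rho1 t) + - (s / 2) * rho1 t)).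
      intros u; ring.
    assert (C1 : forall u, continuous (fun v => cos (s * v) * rho1 v) u).
      apply (expdecay_cos 1 s rho1 rho1_expdecay).
    apply halfline_lim_plus.
    - intros u; apply: (continuous_mult (fun _ => sinh (s / 2)) (fun v => cos (s * v) * rho1 v));
        [apply continuous_const|apply C1].
    - intros u; apply: (continuous_mult (fun _ => - (s / 2)) rho1);
        [apply continuous_const|apply rho1_continuous].
    - now apply halfline_lim_scal.
    - apply halfline_lim_scal; [exact rho1_continuous|exact halfline_rho1_mass].
  assert (E := halfline_lim_unique _ _ _ H2 (halfline_rho1_recentered s Hs)).
  assert (Hsh : sinh (s / 2) <> 0) by (apply sinh_neq_0; lra).
  field_simplify_eq; [lra|easy].
intros Hs; destruct (Rdichotomy s 0 Hs) as [H|H]; [|now apply Hpos].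
replace (cosint rho1 s) with (cosint rho1 (- s)).
  rewrite Hpos; [|lra].
  replace (sinh (- s / 2)) with (- sinh (s / 2)).
    assert (Hsh : sinh (s / 2) <> 0) by (apply sinh_neq_0; lra); field; easy.
  unfold sinh; replace (- s / 2) with (- (s / 2)) by field; rewrite Ropp_involutive; field.
apply lineint_ext; intros u; now rewrite Ropp_mult_distr_l_reverse cos_neg.
Qed.

(** * Differentiation under the integral sign *)

Lemma is_derive_of_quadratic (J : R -> R) (x d M : R) :
  (forall h, Rabs h <= 1 -> Rabs (J (x + h) - J x - h * d) <= M * h ^ 2) ->
  is_derive J x d.
Proof.
intros H; apply is_derive_Reals; intros eps Heps.
assert (HM : 0 <= M).
  generalize (H 1) (Rabs_pos (J (x + 1) - J x - 1 * d)); rewrite Rabs_R1; lra.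
assert (Hd : 0 < Rmin 1 (eps / (M + 1))).
  apply Rmin_glb_lt; [lra|apply Rdiv_lt_0_compat; lra].
exists (mkposreal _ Hd); intros h Hh0 Hh; simpl in Hh.
assert (H1 := Rmin_l 1 (eps / (M + 1))); assert (H2 := Rmin_r 1 (eps / (M + 1))).
assert (Hq := H h ltac:(lra)).
assert (Ha := Rabs_pos_lt h Hh0).
replace ((J (x + h) - J x) / h - d) with ((J (x + h) - J x - h * d) * / h) by (field; easy).
rewrite Rabs_mult Rabs_inv.
apply Rmult_lt_reg_r with (Rabs h); [easy|].
rewrite Rmult_assoc Rinv_l ?Rmult_1_r; [|lra].
rewrite -pow2_abs in Hq.
assert (H3 : Rabs h * (M + 1) < eps).
  replace eps with (eps / (M + 1) * (M + 1)) by (field; lra).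
  apply Rmult_lt_compat_r; lra.
nra.
Qed.

Lemma quadratic_of_lipschitz_derive (f df : R -> R) (x h M : R) :
  (forall t, is_derive f t (df t)) ->
  (forall t, Rabs (t - x) <= Rabs h -> Rabs (df t - df x) <= M * Rabs (t - x)) ->
  0 <= M -> Rabs (f (x + h) - f x - h * df x) <= M * h ^ 2.
Proof.
intros Hd HL HM.
destruct (MVT_gen f x (x + h) df) as [c [Hc E]].
- intros t _; apply Hd.
- intros t _; apply derivable_continuous_pt, ex_derive_Reals_0; eexists; apply Hd.
- replace (f (x + h) - f x - h * df x) with ((df c - df x) * h) by (rewrite E; ring).
  assert (Hch : Rabs (c - x) <= Rabs h).
    revert Hc; unfold Rmin, Rmax, Rabs; destruct (Rle_dec x (x + h));
      destruct (Rcase_abs (c - x)); destruct (Rcase_abs h); intros; lra.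
  rewrite Rabs_mult -(pow2_abs h).
  assert (H1 := HL c Hch); assert (H2 := Rmult_le_compat_l _ _ _ HM Hch).
  replace (M * Rabs h ^ 2) with (M * Rabs h * Rabs h) by ring.
  apply Rmult_le_compat_r; [apply Rabs_pos|lra].
Qed.

(** The quadratic remainder has an integrable weight, so it integrates to a quadratic remainder, and
    that determines the derivative. *)
Lemma lineint_derive (F F' : R -> R -> R) (k M x : R) : 0 < k ->
  (forall y, expdecay k (F y)) -> expdecay k (F' x) ->
  (forall h u, Rabs h <= 1 ->
     Rabs (F (x + h) u - F x u - h * F' x u) <= M * h ^ 2 * exp (- (k * Rabs u))) ->
  is_derive (fun y => lineint (F y)) x (lineint (F' x)).
Proof.
intros Hk HF HF' Hq.
apply is_derive_of_quadratic with (2 * M / k); intros h Hh.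
rewrite -(lineint_scal k) // -(lineint_minus k) //.
assert (Hm : expdecay k (fun u => F (x + h) u - F x u)).
  replace (fun u => F (x + h) u - F x u) with (fun u => F (x + h) u + (-1) * F x u).
    apply expdecay_plus; [apply HF|now apply expdecay_scal].
  apply functional_extensionality; intros u; ring.
rewrite -(lineint_minus k) //; [|now apply expdecay_scal].
replace (2 * M / k * h ^ 2) with (2 * (M * h ^ 2) / k) by (field; lra).
apply lineint_bound; [easy| |].
- intros u; apply: (continuous_minus (fun u => F (x + h) u - F x u) (fun u => h * F' x u)).
    apply Hm.
  now apply (expdecay_scal k).
- intros u; now apply Hq.
Qed.

(** * The cosine transform of a convolution with [rho1] *)

(** The estimate must hold at negative [x] too, since it is applied at [T - u] with [u] arbitrary.
    There boundedness of the primitive suffices, as [exp (- x) >= 1]. Stating parity for its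
    absolute value covers the odd cosine primitive and the even sine primitive at once. *)
Lemma halfline_tail_of_parity (f : R -> R) (C k : R) : 1 <= k ->
  (forall u, continuous f u) -> (forall u, Rabs (f u) <= C * exp (- (k * Rabs u))) ->
  (forall x, Rabs (RInt f 0 (- x)) = Rabs (RInt f 0 x)) ->
  exists L K, halfline_lim f L /\ 0 <= K /\
    forall x, Rabs (RInt f 0 x - L) <= K * exp (- x).
Proof.
intros Hk Hf Hb Hp.
assert (HC : 0 <= C).
  generalize (Hb 0) (Rabs_pos (f 0)); rewrite Rabs_R0 Rmult_0_r Ropp_0 exp_0; lra.
destruct (halfline_lim_tail f C k) as [L [HL HT]]; [lra|easy| |].
  intros u Hu; generalize (Hb u); now rewrite (Rabs_pos_eq u).
assert (HCk : 0 <= C / k) by (apply Rdiv_le_0_compat; lra).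
assert (HT' : forall x, 0 <= x -> Rabs (RInt f 0 x - L) <= C / k * exp (- x)).
  intros x Hx; apply Rle_trans with (1 := HT x Hx).
  apply Rmult_le_compat_l; [easy|apply exp_le_compat; nra].
exists L, (C / k + 2 * Rabs L); split; [easy|].
assert (HL0 := Rabs_pos L); split; [lra|].
intros x; destruct (Rle_dec 0 x) as [Hx|Hx].
  generalize (HT' x Hx) (exp_pos (- x)); nra.
assert (H1 := HT' (- x) ltac:(lra)).
assert (H2 : Rabs (RInt f 0 x) <= C / k + Rabs L).
  rewrite -Hp; replace (RInt f 0 (- x)) with ((RInt f 0 (- x) - L) + L) by lra.
  apply Rle_trans with (1 := Rabs_triang _ _).
  assert (exp (- - x) <= exp 0) by (apply exp_le_compat; lra).
  rewrite exp_0 in H; nra.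
assert (H3 : exp 0 <= exp (- x)) by (apply exp_le_compat; lra); rewrite exp_0 in H3.
apply Rle_trans with (1 := Rabs_triang _ _); rewrite Rabs_Ropp; nra.
Qed.

Definition cos_prim (s x : R) : R := RInt (fun v => cos (s * v) * rho1 v) 0 x.
Definition sin_prim (s x : R) : R := RInt (fun v => sin (s * v) * rho1 v) 0 x.

Lemma continuous_cos_rho1 (s u : R) : continuous (fun v => cos (s * v) * rho1 v) u.
Proof. apply: (continuous_mult _ rho1); [apply continuous_cos_scal|apply rho1_continuous]. Qed.

Lemma continuous_sin_rho1 (s u : R) : continuous (fun v => sin (s * v) * rho1 v) u.
Proof. apply: (continuous_mult _ rho1); [apply continuous_sin_scal|apply rho1_continuous]. Qed.

Lemma cos_prim_odd (s x : R) : cos_prim s (- x) = - cos_prim s x.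
Proof.
unfold cos_prim; rewrite -RInt_flip; [|apply continuous_cos_rho1].
apply RInt_ext; intros v _; now rewrite rho1_even Ropp_mult_distr_r_reverse cos_neg.
Qed.

Lemma sin_prim_even (s x : R) : sin_prim s (- x) = sin_prim s x.
Proof.
unfold sin_prim; rewrite -(Ropp_involutive (RInt _ 0 x)) -RInt_flip; [|apply continuous_sin_rho1].
transitivity (RInt (fun v => opp (sin (s * - v) * rho1 (- v))) 0 (- x)).
  apply RInt_ext; intros v _; rewrite rho1_even Ropp_mult_distr_r_reverse sin_neg.
  unfold opp; simpl; ring.
apply: (RInt_opp (fun v => sin (s * - v) * rho1 (- v))).
apply continuous_ex_RInt.
apply (continuous_flip (fun v => sin (s * v) * rho1 v)), continuous_sin_rho1.
Qed.

Lemma is_derive_prim (f : R -> R) (x : R) :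
  (forall u, continuous f u) -> is_derive (fun y => RInt f 0 y) x (f x).
Proof.
intros Hf; apply: is_derive_RInt; [|apply Hf].
apply filter_forall; intros y; apply: RInt_correct; now apply continuous_ex_RInt.
Qed.

(* [trunc s T u] is [\int_{-T}^T cos (s t) rho1 (t - u) dt], expanded by the addition formula
   so that its derivative in [T] and its limit as [T -> oo] can be read off. *)
Definition trunc (s T u : R) : R :=
  cos (s * u) * (cos_prim s (T - u) + cos_prim s (T + u))
  - sin (s * u) * (sin_prim s (T - u) - sin_prim s (T + u)).

Definition trunc' (s T u : R) : R := cos (s * T) * (rho1 (T - u) + rho1 (T + u)).

Lemma trunc_derive (s T u : R) : is_derive (fun t => trunc s t u) T (trunc' s T u).
Proof.
assert (Hc : forall x, is_derive (cos_prim s) x (cos (s * x) * rho1 x)).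
  intros x; apply (is_derive_prim (fun v => cos (s * v) * rho1 v)), continuous_cos_rho1.
assert (Hs : forall x, is_derive (sin_prim s) x (sin (s * x) * rho1 x)).
  intros x; apply (is_derive_prim (fun v => sin (s * v) * rho1 v)), continuous_sin_rho1.
assert (Hm : is_derive (fun t => t - u) T 1) by (auto_derive; [easy|ring]).
assert (Hp : is_derive (fun t => t + u) T 1) by (auto_derive; [easy|ring]).
assert (H1 := is_derive_comp (cos_prim s) (fun t => t - u) T _ _ (Hc (T - u)) Hm).
assert (H2 := is_derive_comp (cos_prim s) (fun t => t + u) T _ _ (Hc (T + u)) Hp).
assert (H3 := is_derive_comp (sin_prim s) (fun t => t - u) T _ _ (Hs (T - u)) Hm).
assert (H4 := is_derive_comp (sin_prim s) (fun t => t + u) T _ _ (Hs (T + u)) Hp).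
assert (H5 := is_derive_minus _ _ _ _ _
  (is_derive_scal _ _ (cos (s * u)) _ (is_derive_plus _ _ _ _ _ H1 H2))
  (is_derive_scal _ _ (sin (s * u)) _ (is_derive_minus _ _ _ _ _ H3 H4))).
apply: is_derive_eq H5 _.
unfold trunc', scal, minus, plus, opp; simpl; unfold mult; simpl.
assert (E1 : cos (s * T) = cos (s * (T - u)) * cos (s * u) - sin (s * (T - u)) * sin (s * u)).
  rewrite -cos_plus; f_equal; ring.
assert (E2 : cos (s * T) = cos (s * (T + u)) * cos (s * u) + sin (s * (T + u)) * sin (s * u)).
  rewrite -cos_minus; f_equal; ring.
transitivity (cos (s * T) * rho1 (T - u) + cos (s * T) * rho1 (T + u)); [|ring].
rewrite {1}E1 E2; ring.
Qed.

Lemma trunc_0 (s u : R) : trunc s 0 u = 0.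
Proof.
unfold trunc; rewrite Rplus_0_l Rminus_0_l cos_prim_odd sin_prim_even; ring.
Qed.

(** Both [T - u] and [T + u] are at least [T - |u|], hence the loss of [exp |u|]. The two cosine
    primitives tend to [cosint rho1 s / 2] each, while the limits of the sine primitives cancel in
    the difference. *)
Lemma trunc_limit (s : R) : exists K, 0 <= K /\ forall T u,
  Rabs (trunc s T u - cosint rho1 s * cos (s * u)) <= K * exp (- T) * exp (Rabs u).
Proof.
assert (Hb : forall (w : R -> R), (forall u, Rabs (w u) <= 1) ->
    forall u, Rabs (w u * rho1 u) <= 8 * exp (- (4 * Rabs u))).
  intros w Hw u; rewrite Rabs_mult -(Rmult_1_l (8 * _)).
  apply Rmult_le_compat; auto using Rabs_pos, rho1_bound.
destruct (halfline_tail_of_parity (fun v => cos (s * v) * rho1 v) 8 4)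
  as [Lc [Kc [HLc [HKc Hc]]]]; [lra|apply continuous_cos_rho1| | |].
- apply (Hb (fun u => cos (s * u))); intros u; apply Rabs_le, COS_bound.
- intros x; change (Rabs (cos_prim s (- x)) = Rabs (cos_prim s x)).
  now rewrite cos_prim_odd Rabs_Ropp.
- destruct (halfline_tail_of_parity (fun v => sin (s * v) * rho1 v) 8 4)
    as [Ls [Ks [_ [HKs Hs]]]]; [lra|apply continuous_sin_rho1| | |].
  + apply (Hb (fun u => sin (s * u))); intros u; apply Rabs_le, SIN_bound.
  + intros x; change (Rabs (sin_prim s (- x)) = Rabs (sin_prim s x)).
    now rewrite sin_prim_even.
  + exists (2 * Kc + 2 * Ks); split; [lra|]; intros T u.
    assert (EL : cosint rho1 s = 2 * Lc).
      assert (H := halfline_lim_unique _ _ _ HLc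
        (cosint_halfline 1 s rho1 Rlt_0_1 rho1_expdecay rho1_even)); lra.
    assert (Ex : forall x, T - Rabs u <= x -> exp (- x) <= exp (- T) * exp (Rabs u)).
      intros x Hx; rewrite -exp_plus; apply exp_le_compat; lra.
    assert (Hu1 : T - Rabs u <= T - u) by (generalize (Rle_abs u); lra).
    assert (Hu2 : T - Rabs u <= T + u) by (generalize (Rle_abs (- u)); rewrite Rabs_Ropp; lra).
    assert (Bc : forall x, T - Rabs u <= x ->
        Rabs (cos_prim s x - Lc) <= Kc * (exp (- T) * exp (Rabs u))).
      intros x Hx; apply Rle_trans with (1 := Hc x); apply Rmult_le_compat_l; auto.
    assert (Bs : forall x, T - Rabs u <= x ->
        Rabs (sin_prim s x - Ls) <= Ks * (exp (- T) * exp (Rabs u))).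
      intros x Hx; apply Rle_trans with (1 := Hs x); apply Rmult_le_compat_l; auto.
    replace (trunc s T u - cosint rho1 s * cos (s * u)) with
      (cos (s * u) * ((cos_prim s (T - u) - Lc) + (cos_prim s (T + u) - Lc))
       + sin (s * u) * ((sin_prim s (T + u) - Ls) + - (sin_prim s (T - u) - Ls)))
      by (unfold trunc; rewrite EL; ring).
    assert (Tri : forall w a b X, Rabs w <= 1 -> Rabs a <= X -> Rabs b <= X ->
        Rabs (w * (a + b)) <= 2 * X).
      intros w a b X Hw Ha Hb'; rewrite Rabs_mult.
      assert (H := Rabs_triang a b); generalize (Rabs_pos w) (Rabs_pos (a + b)); nra.
    apply Rle_trans with (1 := Rabs_triang _ _).
    replace ((2 * Kc + 2 * Ks) * exp (- T) * exp (Rabs u)) with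
      (2 * (Kc * (exp (- T) * exp (Rabs u))) + 2 * (Ks * (exp (- T) * exp (Rabs u)))) by ring.
    apply Rplus_le_compat; apply Tri; auto.
    * apply Rabs_le, COS_bound.
    * apply Rabs_le, SIN_bound.
    * rewrite Rabs_Ropp; auto.
Qed.

Lemma trunc'_lipschitz (s T t u : R) :
  Rabs (trunc' s t u - trunc' s T u) <= (16 * Rabs s + 32) * Rabs (t - T).
Proof.
unfold trunc'.
replace (cos (s * t) * (rho1 (t - u) + rho1 (t + u)) - cos (s * T) * (rho1 (T - u) + rho1 (T + u)))
  with ((cos (s * t) - cos (s * T)) * (rho1 (t - u) + rho1 (t + u))
    + cos (s * T) * ((rho1 (t - u) - rho1 (T - u)) + (rho1 (t + u) - rho1 (T + u)))) by ring.
assert (H1 := lipschitz_of_derive (fun x => cos (s * x)) (fun x => - s * sin (s * x)) (Rabs s) T t).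
assert (H1' : Rabs (cos (s * t) - cos (s * T)) <= Rabs s * Rabs (t - T)).
  apply H1.
  - intros x; auto_derive; [easy|ring].
  - intros x; rewrite Rabs_mult Rabs_Ropp -{2}(Rmult_1_r (Rabs s)).
    apply Rmult_le_compat_l; [apply Rabs_pos|apply Rabs_le, SIN_bound].
assert (H2 := rho1_lipschitz (T - u) (t - u)); assert (H3 := rho1_lipschitz (T + u) (t + u)).
replace (t - u - (T - u)) with (t - T) in H2 by ring.
replace (t + u - (T + u)) with (t - T) in H3 by ring.
assert (H4 : Rabs (cos (s * T)) <= 1) by (apply Rabs_le, COS_bound).
apply Rle_trans with (1 := Rabs_triang _ _).
rewrite (Rabs_mult (cos (s * t) - _)) (Rabs_mult (cos (s * T))).
assert (H5 := Rabs_triang (rho1 (t - u)) (rho1 (t + u))).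
assert (H6 := Rabs_triang (rho1 (t - u) - rho1 (T - u)) (rho1 (t + u) - rho1 (T + u))).
assert (H7 := rho1_le_8 (t - u)); assert (H8 := rho1_le_8 (t + u)).
assert (A1 : Rabs (cos (s * t) - cos (s * T)) * Rabs (rho1 (t - u) + rho1 (t + u)) <=
   Rabs s * Rabs (t - T) * 16).
  apply Rmult_le_compat; auto using Rabs_pos; lra.
assert (A2 : Rabs (cos (s * T)) * Rabs (rho1 (t - u) - rho1 (T - u) + (rho1 (t + u) - rho1 (T + u)))
   <= 1 * (32 * Rabs (t - T))).
  apply Rmult_le_compat; auto using Rabs_pos; lra.
lra.
Qed.

Lemma continuous_trunc (s T u : R) : continuous (fun v => trunc s T v) u.
Proof.
assert (Hc : forall x, continuous (cos_prim s) x).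
  intros x; apply: ex_derive_continuous; eexists; apply is_derive_prim, continuous_cos_rho1.
assert (Hs : forall x, continuous (sin_prim s) x).
  intros x; apply: ex_derive_continuous; eexists; apply is_derive_prim, continuous_sin_rho1.
assert (Hp : forall f : R -> R, (forall x, continuous f x) ->
    forall x, continuous (fun v => f (T + v)) x).
  intros f Hf x; apply: continuous_comp; [|apply Hf].
  apply: (continuous_plus (fun _ => T) (fun v => v)); [apply continuous_const|apply continuous_id].
apply: (continuous_minus
  (fun v => cos (s * v) * (cos_prim s (T - v) + cos_prim s (T + v)))
  (fun v => sin (s * v) * (sin_prim s (T - v) - sin_prim s (T + v)))).
- apply: (continuous_mult (fun v => cos (s * v))); [apply continuous_cos_scal|].
  apply: (continuous_plus (fun v => cos_prim s (T - v)) (fun v => cos_prim s (T + v)));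
    [now apply continuous_shift|now apply Hp].
- apply: (continuous_mult (fun v => sin (s * v))); [apply continuous_sin_scal|].
  apply: (continuous_minus (fun v => sin_prim s (T - v)) (fun v => sin_prim s (T + v)));
    [now apply continuous_shift|now apply Hp].
Qed.

(** Let [J T] be the integral of [trunc s T u * g u] in [u]. Differentiating in [T] turns [trunc]
    into values of [rho1], so [J'] is the even part of [cos (s T) * conv_rho1 g T]; since [J 0 = 0],
    [J] is its truncated integral. The limit of [trunc] gives the product on the right. *)
Lemma cosint_conv_rho1 (g : R -> R) (s : R) : rholike g ->
  cosint (conv_rho1 g) s = cosint rho1 s * cosint g s.
Proof.
intros Hg; assert (Hcv := conv_rho1_rholike g Hg); destruct Hg as [He Hg].
destruct (trunc_limit s) as [K [HK Hlim]].
(* Rate 2 pays for the [exp |u|] of [trunc_limit] and leaves rate 1. *)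
destruct (Hg 2) as [Hgc [C HC]]; [lra|].
assert (Hg1 : expdecay 1 g) by (apply Hg; lra).
assert (HC0 : 0 <= C).
  generalize (HC 0) (Rabs_pos (g 0)); rewrite Rabs_R0 Rmult_0_r Ropp_0 exp_0; lra.
assert (Hexp : forall u, exp (- (2 * Rabs u)) * exp (Rabs u) = exp (- (1 * Rabs u))).
  intros u; rewrite -exp_plus; f_equal; ring.
assert (Herr : forall T u, Rabs (trunc s T u * g u - cosint rho1 s * (cos (s * u) * g u))
    <= C * K * exp (- T) * exp (- (1 * Rabs u))).
  intros T u.
  replace (trunc s T u * g u - cosint rho1 s * (cos (s * u) * g u)) with
    (g u * (trunc s T u - cosint rho1 s * cos (s * u))) by ring.
  rewrite Rabs_mult -Hexp.
  replace (C * K * exp (- T) * (exp (- (2 * Rabs u)) * exp (Rabs u))) with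
    (C * exp (- (2 * Rabs u)) * (K * exp (- T) * exp (Rabs u))) by ring.
  apply Rmult_le_compat; auto using Rabs_pos.
assert (Hcg : expdecay 1 (fun u => cosint rho1 s * (cos (s * u) * g u))).
  apply (expdecay_scal 1 (cosint rho1 s) (fun u => cos (s * u) * g u)); now apply expdecay_cos.
assert (Htr : forall T, expdecay 1 (fun u => trunc s T u * g u)).
  intros T.
  (* Decay of [trunc s T u * g u] is obtained as that of its error term plus that of its limit. *)
  assert (Hd : expdecay 1 (fun u => trunc s T u * g u - cosint rho1 s * (cos (s * u) * g u))).
    split; [|eexists; apply Herr].
    intros u; apply: (continuous_minus (fun v => trunc s T v * g v)
      (fun v => cosint rho1 s * (cos (s * v) * g v))); [|apply Hcg].
    apply: (continuous_mult (fun v => trunc s T v) g); [apply continuous_trunc|apply Hgc].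
  assert (H := expdecay_plus _ _ _ Hd Hcg).
  replace (fun u => trunc s T u * g u) with (fun u => trunc s T u * g u -
    cosint rho1 s * (cos (s * u) * g u) + cosint rho1 s * (cos (s * u) * g u)); [exact H|].
  apply functional_extensionality; intros u; ring.
assert (Hcr : forall t, expdecay 1 (fun u => g u * rho1 (t - u))).
  intros t; now apply conv_integrand_expdecay.
assert (Hcr' : forall t, expdecay 1 (fun u => g u * rho1 (t + u))).
  intros t; destruct (Hcr t) as [H1 [D HD]]; split.
  - intros u; apply (continuous_ext (fun v => g (- v) * rho1 (t - - v))).
      intros v; rewrite He; f_equal; f_equal; ring.
    now apply (continuous_flip (fun v => g v * rho1 (t - v))).
  - exists D; intros u; generalize (HD (- u)); rewrite He Rabs_Ropp; now replace (t - - u) with (t + u) by ring.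
assert (Htr' : forall T, expdecay 1 (fun u => trunc' s T u * g u)).
  intros T.
  replace (fun u => trunc' s T u * g u) with
    (fun u => cos (s * T) * (g u * rho1 (T - u) + g u * rho1 (T + u))).
    apply (expdecay_scal 1 (cos (s * T)) (fun u => g u * rho1 (T - u) + g u * rho1 (T + u))).
    now apply (expdecay_plus 1 (fun u => g u * rho1 (T - u))).
  apply functional_extensionality; intros u; unfold trunc'; ring.
assert (HJ' : forall T, lineint (fun u => trunc' s T u * g u) =
    cos (s * T) * conv_rho1 g T + cos (s * - T) * conv_rho1 g (- T)).
  intros T.
  rewrite (lineint_ext _ (fun u => cos (s * T) * (g u * rho1 (T - u) + g u * rho1 (T + u)))).
    2: intros u; unfold trunc'; ring.
  rewrite (lineint_scal 1 (cos (s * T)) (fun u => g u * rho1 (T - u) + g u * rho1 (T + u))); [|lra|].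
    2: now apply (expdecay_plus 1 (fun u => g u * rho1 (T - u))).
  rewrite (lineint_plus 1 (fun u => g u * rho1 (T - u))) //; [|lra].
  (* Evenness turns [rho1 (T + u)] into [rho1 (- T - u)], the integrand of the convolution at
     [- T]. *)
  rewrite Ropp_mult_distr_r_reverse cos_neg -Rmult_plus_distr_l; f_equal; f_equal.
  apply lineint_ext; intros u; f_equal; rewrite -rho1_even; f_equal; ring.
assert (HJ : forall T, is_derive (fun t => lineint (fun u => trunc s t u * g u)) T
    (cos (s * T) * conv_rho1 g T + cos (s * - T) * conv_rho1 g (- T))).
  intros T; rewrite -HJ'.
  apply (lineint_derive (fun t u => trunc s t u * g u) (fun t u => trunc' s t u * g u) 1
    ((16 * Rabs s + 32) * C)); auto; [lra|].
  intros h u Hh.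
  replace (trunc s (T + h) u * g u - trunc s T u * g u - h * (trunc' s T u * g u)) with
    ((trunc s (T + h) u - trunc s T u - h * trunc' s T u) * g u) by ring.
  rewrite Rabs_mult.
  replace ((16 * Rabs s + 32) * C * h ^ 2 * exp (- (1 * Rabs u))) with
    ((16 * Rabs s + 32) * h ^ 2 * (C * exp (- (1 * Rabs u)))) by ring.
  apply Rmult_le_compat; auto using Rabs_pos.
    apply (quadratic_of_lipschitz_derive (fun t => trunc s t u) (fun t => trunc' s t u)).
    + intros t; apply trunc_derive.
    + intros t _; apply trunc'_lipschitz.
    + generalize (Rabs_pos s); lra.
  apply Rle_trans with (1 := HC u); apply Rmult_le_compat_l; [easy|].
  apply exp_le_compat; generalize (Rabs_pos u); lra.
assert (Hf : expdecay 1 (fun t => cos (s * t) * conv_rho1 g t)).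
  apply expdecay_cos, Hcv; lra.
apply (halfline_lim_unique (fun t => cos (s * t) * conv_rho1 g t + cos (s * - t) * conv_rho1 g (- t))).
  apply (expdecay_line_lim 1 (fun t => cos (s * t) * conv_rho1 g t)); [lra|easy].
apply halfline_lim_exp_rate with (2 * (C * K) / 1); intros x Hx.
(* Both sides vanish at [x = 0] and have equal derivatives, by [trunc_0] and [HJ]. *)
assert (E : RInt (fun t => cos (s * t) * conv_rho1 g t + cos (s * - t) * conv_rho1 g (- t)) 0 x
    = lineint (fun u => trunc s x u * g u)).
  apply is_RInt_unique.
  replace (lineint (fun u => trunc s x u * g u)) with
    (minus (lineint (fun u => trunc s x u * g u)) (lineint (fun u => trunc s 0 u * g u))).
    apply: (is_RInt_derive (fun t => lineint (fun u => trunc s t u * g u))).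
      intros t _; apply HJ.
    intros t _; apply (continuous_flip_plus (fun t => cos (s * t) * conv_rho1 g t)), Hf.
  rewrite (lineint_ext (fun u => trunc s 0 u * g u) (fun u => 0 * g u)).
    rewrite (lineint_scal 1) //; [|lra].
    unfold minus, plus, opp; simpl; ring.
  intros u; now rewrite trunc_0.
rewrite E; unfold cosint at 2.
rewrite -(lineint_scal 1 (cosint rho1 s) (fun u => cos (s * u) * g u)); [|lra|now apply expdecay_cos].
rewrite -(lineint_minus 1) //; [|lra].
replace (2 * (C * K) / 1 * exp (- x)) with (2 * (C * K * exp (- x)) / 1) by field.
apply lineint_bound; [lra| |intros u; apply Herr].
intros u; apply: (continuous_minus (fun v => trunc s x v * g v)
      (fun v => cosint rho1 s * (cos (s * v) * g v))); [apply Htr|apply Hcg].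
Qed.

Lemma cosint_rho (l : nat) (s : R) : (1 <= l)%nat -> cosint (rho l) s = cosint rho1 s ^ l.
Proof.
intros Hl; induction Hl as [|l Hl IH].
- rewrite pow_1; reflexivity.
- rewrite rho_succ // cosint_conv_rho1; [|apply rho_rholike].
  now rewrite IH.
Qed.

(** * Moments and Bernoulli numbers *)

(* Real and imaginary part of [(- (a + i u)) ^ r]. *)
Fixpoint negpow (a u : R) (r : nat) : R * R :=
  match r with
  | O => (1, 0)
  | S r' => (- (a * fst (negpow a u r') - u * snd (negpow a u r')),
             - (a * snd (negpow a u r') + u * fst (negpow a u r')))
  end.

Definition negpow_re (a u : R) (r : nat) : R := fst (negpow a u r).
Definition negpow_im (a u : R) (r : nat) : R := snd (negpow a u r).

Lemma negpow_re_S (a u : R) (r : nat) :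
  negpow_re a u (S r) = - (a * negpow_re a u r - u * negpow_im a u r).
Proof. reflexivity. Qed.

Lemma negpow_im_S (a u : R) (r : nat) :
  negpow_im a u (S r) = - (a * negpow_im a u r + u * negpow_re a u r).
Proof. reflexivity. Qed.

Lemma negpow_bound (a u : R) (r : nat) :
  Rabs (negpow_re a u r) + Rabs (negpow_im a u r) <= (Rabs a + Rabs u) ^ r.
Proof.
induction r as [|r IH].
  unfold negpow_re, negpow_im; simpl; rewrite Rabs_R1 Rabs_R0; lra.
rewrite negpow_re_S negpow_im_S !Rabs_Ropp.
set (p := negpow_re a u r) in *; set (q := negpow_im a u r) in *.
assert (H1 := Rabs_triang (a * p) (- (u * q))); rewrite Rabs_Ropp !Rabs_mult in H1.
assert (H2 := Rabs_triang (a * q) (u * p)); rewrite !Rabs_mult in H2.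
apply Rle_trans with ((Rabs a + Rabs u) * (Rabs p + Rabs q)); [unfold Rminus; lra|].
simpl; apply Rmult_le_compat_l; [|easy].
generalize (Rabs_pos a) (Rabs_pos u); lra.
Qed.

Lemma negpow_continuous (a : R) (r : nat) : forall u,
  continuous (fun v => negpow_re a v r) u /\ continuous (fun v => negpow_im a v r) u.
Proof.
induction r as [|r IH]; intros u.
  split; apply continuous_const.
destruct (IH u) as [H1 H2]; split.
- apply: (continuous_opp (fun v => a * negpow_re a v r - v * negpow_im a v r)).
  apply: (continuous_minus (fun v => a * negpow_re a v r) (fun v => v * negpow_im a v r)).
    apply: (continuous_mult (fun _ => a)); [apply continuous_const|easy].
  apply: (continuous_mult (fun v => v)); [apply continuous_id|easy].
- apply: (continuous_opp (fun v => a * negpow_im a v r + v * negpow_re a v r)).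
  apply: (continuous_plus (fun v => a * negpow_im a v r) (fun v => v * negpow_re a v r)).
    apply: (continuous_mult (fun _ => a)); [apply continuous_const|easy].
  apply: (continuous_mult (fun v => v)); [apply continuous_id|easy].
Qed.

(** A single term of the exponential series: [(b + x) ^ r / r! <= exp (b + x)]. *)
Lemma pow_le_exp (r : nat) (b : R) : 0 <= b ->
  exists K, 0 <= K /\ forall x, 0 <= x -> (b + x) ^ r <= K * exp x.
Proof.
intros Hb; exists (INR (Factorial.fact r) * exp b).
assert (Hf := INR_fact_lt_0 r); split.
  apply Rmult_le_pos; [lra|apply Rlt_le, exp_pos].
intros x Hx; rewrite Rmult_assoc -exp_plus.
assert (H := exp_ge_taylor (b + x) r ltac:(lra)).
assert (Ht : (b + x) ^ r / INR (Factorial.fact r) <= exp (b + x)).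
  apply Rle_trans with (2 := H).
  assert (Hpos : forall k, 0 <= (b + x) ^ k / INR (Factorial.fact k)).
    intros k; apply Rdiv_le_0_compat; [apply pow_le; lra|apply INR_fact_lt_0].
  destruct r as [|r]; [apply Rle_refl|].
  rewrite tech5; generalize (cond_pos_sum _ r Hpos); lra.
apply Rmult_le_compat_l with (r := INR (Factorial.fact r)) in Ht; [|lra].
replace (INR (Factorial.fact r) * ((b + x) ^ r / INR (Factorial.fact r))) with ((b + x) ^ r) in Ht by (field; lra).
exact Ht.
Qed.

(** [C] is chosen before [f] and [D], so the bound is uniform when [f] depends on a parameter. *)
Lemma rholike_growth (g : R -> R) : rholike g -> exists C, 0 <= C /\
  forall f D, 0 <= D -> (forall u, Rabs (f u) <= D * exp (Rabs u)) ->
  forall u, Rabs (f u * g u) <= D * C * exp (- (1 * Rabs u)).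
Proof.
intros [_ Hg]; destruct (Hg 2) as [_ [C HC]]; [lra|].
exists C; split.
  generalize (HC 0) (Rabs_pos (g 0)); rewrite Rabs_R0 Rmult_0_r Ropp_0 exp_0; lra.
intros f D HD Hf u; rewrite Rabs_mult.
replace (D * C * exp (- (1 * Rabs u))) with
  ((D * exp (Rabs u)) * (C * exp (- (2 * Rabs u)))).
  apply Rmult_le_compat; auto using Rabs_pos.
replace (- (1 * Rabs u)) with (Rabs u + - (2 * Rabs u)) by ring.
rewrite exp_plus; ring.
Qed.

Lemma expdecay_growth (g f : R -> R) (D : R) : rholike g -> 0 <= D ->
  (forall u, continuous f u) -> (forall u, Rabs (f u) <= D * exp (Rabs u)) ->
  expdecay 1 (fun u => f u * g u).
Proof.
intros Hg HD Hf Hb; split.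
- intros u; apply: (continuous_mult f g); [apply Hf|apply (proj2 Hg 1); lra].
- destruct (rholike_growth g Hg) as [C [_ HC]]; exists (D * C); now apply HC.
Qed.

(* Real part of [(- (a + i u)) ^ r * exp (- z (a + i u))], the r-th derivative in [z] of
   [Re (exp (- z (a + i u)))]. *)
Definition expker (a : R) (r : nat) (z u : R) : R :=
  exp (- (a * z)) * (negpow_re a u r * cos (z * u) + negpow_im a u r * sin (z * u)).

Lemma expker_derive (a : R) (r : nat) (z u : R) :
  is_derive (fun y => expker a r y u) z (expker a (S r) z u).
Proof.
unfold expker; rewrite negpow_re_S negpow_im_S; auto_derive; [easy|ring].
Qed.

Lemma expker_bound (a : R) (r : nat) (z u : R) :
  Rabs (expker a r z u) <= exp (Rabs a * Rabs z) * (Rabs a + Rabs u) ^ r.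
Proof.
unfold expker; rewrite Rabs_mult.
apply Rmult_le_compat; auto using Rabs_pos.
- rewrite Rabs_pos_eq; [|apply Rlt_le, exp_pos]; apply exp_le_compat.
  rewrite -Rabs_mult -Rabs_Ropp; apply Rle_abs.
- apply Rle_trans with (2 := negpow_bound a u r).
  apply Rle_trans with (1 := Rabs_triang _ _); rewrite !Rabs_mult.
  assert (H1 : Rabs (cos (z * u)) <= 1) by (apply Rabs_le, COS_bound).
  assert (H2 : Rabs (sin (z * u)) <= 1) by (apply Rabs_le, SIN_bound).
  generalize (Rabs_pos (negpow_re a u r)) (Rabs_pos (negpow_im a u r)); nra.
Qed.

Lemma continuous_expker (a : R) (r : nat) (z u : R) : continuous (fun v => expker a r z v) u.
Proof.
destruct (negpow_continuous a r u) as [H1 H2].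
apply: (continuous_mult (fun _ => exp (- (a * z)))); [apply continuous_const|].
apply: (continuous_plus (fun v => negpow_re a v r * cos (z * v))
                        (fun v => negpow_im a v r * sin (z * v))).
- apply: (continuous_mult (fun v => negpow_re a v r)); [easy|apply continuous_cos_scal].
- apply: (continuous_mult (fun v => negpow_im a v r)); [easy|apply continuous_sin_scal].
Qed.

Lemma expker_growth (a : R) (r : nat) (Z : R) : exists D, 0 <= D /\
  forall z u, Rabs z <= Z -> Rabs (expker a r z u) <= D * exp (Rabs u).
Proof.
destruct (pow_le_exp r (Rabs a) (Rabs_pos a)) as [K [HK HKx]].
exists (exp (Rabs a * Z) * K); split.
  apply Rmult_le_pos; [apply Rlt_le, exp_pos|easy].
intros z u Hz; apply Rle_trans with (1 := expker_bound a r z u).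
rewrite Rmult_assoc; apply Rmult_le_compat.
- apply Rlt_le, exp_pos.
- apply pow_le; generalize (Rabs_pos a) (Rabs_pos u); lra.
- apply exp_le_compat, Rmult_le_compat_l; [apply Rabs_pos|easy].
- apply HKx, Rabs_pos.
Qed.

Lemma expker_expdecay (g : R -> R) (a : R) (r : nat) (z : R) :
  rholike g -> expdecay 1 (fun u => expker a r z u * g u).
Proof.
intros Hg; destruct (expker_growth a r (Rabs z)) as [D [HD H]].
apply (expdecay_growth g (expker a r z) D Hg HD).
- intros u; apply continuous_expker.
- intros u; apply H; lra.
Qed.

Lemma lineint_expker_derive (g : R -> R) (a : R) (r : nat) (z : R) : rholike g ->
  is_derive (fun y => lineint (fun u => expker a r y u * g u)) z
    (lineint (fun u => expker a (S r) z u * g u)).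
Proof.
(* The second derivative controls the quadratic remainder; increments have [|h| <= 1], whence the
   radius [Rabs z + 1]. *)
intros Hg; destruct (expker_growth a (S (S r)) (Rabs z + 1)) as [D [HD H]].
destruct (rholike_growth g Hg) as [C [HC0 HC]].
apply (lineint_derive (fun y u => expker a r y u * g u)
  (fun y u => expker a (S r) y u * g u) 1 (D * C)); [lra| | |].
- intros y; now apply expker_expdecay.
- now apply expker_expdecay.
- intros h u Hh.
  replace (expker a r (z + h) u * g u - expker a r z u * g u - h * (expker a (S r) z u * g u))
    with ((expker a r (z + h) u - expker a r z u - h * expker a (S r) z u) * g u) by ring.
  replace (D * C * h ^ 2) with ((D * h ^ 2) * C) by ring.
  apply (HC (fun u => expker a r (z + h) u - expker a r z u - h * expker a (S r) z u)).
    apply Rmult_le_pos; [easy|apply pow2_ge_0].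
  clear u; intros u.
  replace (D * h ^ 2 * exp (Rabs u)) with (D * exp (Rabs u) * h ^ 2) by ring.
  assert (HDu : 0 <= D * exp (Rabs u)) by (apply Rmult_le_pos; [easy|apply Rlt_le, exp_pos]).
  apply (quadratic_of_lipschitz_derive (fun y => expker a r y u) (fun y => expker a (S r) y u)).
  + intros t; apply expker_derive.
  + intros t Ht.
    destruct (MVT_gen (fun y => expker a (S r) y u) z t (fun y => expker a (S (S r)) y u))
      as [c [Hc E]].
    * intros y _; apply expker_derive.
    * intros y _; apply derivable_continuous_pt, ex_derive_Reals_0; eexists; apply expker_derive.
    * rewrite E Rabs_mult; apply Rmult_le_compat_r; [apply Rabs_pos|].
      apply H.
      assert (Hcz : Rabs (c - z) <= Rabs (t - z)).
        revert Hc; unfold Rmin, Rmax, Rabs; destruct (Rle_dec z t);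
        destruct (Rcase_abs (c - z)); destruct (Rcase_abs (t - z)); intros; lra.
      replace c with (z + (c - z)) by ring.
      apply Rle_trans with (1 := Rabs_triang _ _); lra.
  + easy.
Qed.

Lemma Derive_n_lineint_expker (g : R -> R) (a : R) (r : nat) (z : R) : rholike g ->
  Derive_n (fun y => lineint (fun u => expker a 0 y u * g u)) r z =
  lineint (fun u => expker a r z u * g u).
Proof.
intros Hg; revert z; induction r as [|r IH]; intros z; [reflexivity|].
simpl; rewrite (Derive_ext _ _ _ IH).
now apply is_derive_unique, lineint_expker_derive.
Qed.

Lemma exp_mult_INR (n : nat) (x : R) : exp (INR n * x) = exp x ^ n.
Proof.
induction n as [|n IH]; [rewrite Rmult_0_l exp_0; reflexivity|].
rewrite S_INR Rmult_plus_distr_r Rmult_1_l exp_plus IH; simpl; ring.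
Qed.

(** Uses [z / (exp z - 1) = exp (- z / 2) * (z / 2) / sinh (z / 2)]. As the equality holds at every
    [z], 0 included, all derivatives at 0 carry over by extensionality. *)
Lemma bern_gen_lineint (l : nat) (z : R) : (1 <= l)%nat ->
  bern_gen l z = lineint (fun u => expker (INR l / 2) 0 z u * rho l u).
Proof.
intros Hl.
assert (E : lineint (fun u => expker (INR l / 2) 0 z u * rho l u) =
    exp (- (INR l / 2 * z)) * cosint rho1 z ^ l).
  rewrite -cosint_rho //.
  rewrite -(lineint_scal 1 _ (fun u => cos (z * u) * rho l u)); [|lra|].
    apply lineint_ext; intros u; unfold expker, negpow_re, negpow_im; simpl; ring.
  apply expdecay_cos, rho_rholike; lra.
rewrite E; replace (- (INR l / 2 * z)) with (INR l * (- (z / 2))) by field.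
rewrite exp_mult_INR -Rpow_mult_distr.
unfold bern_gen; destruct (Req_EM_T z 0) as [Hz|Hz].
  rewrite Hz cosint_rho1_0 Rmult_1_r; replace (- (0 / 2)) with 0 by field.
  now rewrite exp_0 pow1.
f_equal; rewrite cosint_rho1 //.
assert (Hz2 : z / 2 <> 0) by lra.
assert (Hs := sinh_neq_0 _ Hz2).
assert (Ez : exp z = exp (z / 2) * exp (z / 2)) by (rewrite -exp_plus; f_equal; field).
assert (Es : sinh (z / 2) = (exp z - 1) / (2 * exp (z / 2))).
  assert (Hw := exp_pos (z / 2)); unfold sinh; rewrite exp_Ropp Ez; field; lra.
rewrite Es in Hs |- *; rewrite exp_Ropp.
assert (Hw := exp_pos (z / 2)).
assert (exp z - 1 <> 0).
  intros H; apply Hs; rewrite H; unfold Rdiv; ring.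
field; split; first [assumption|lra].
Qed.

Lemma bernoulli_l_lineint (l r : nat) : (1 <= l)%nat ->
  bernoulli_l l r = lineint (fun u => negpow_re (INR l / 2) u r * rho l u).
Proof.
intros Hl; unfold bernoulli_l.
rewrite (Derive_n_ext _ _ _ _ (fun z => bern_gen_lineint l z Hl)).
rewrite Derive_n_lineint_expker; [|apply rho_rholike].
apply lineint_ext; intros u; unfold expker.
rewrite Rmult_0_r Ropp_0 exp_0 Rmult_0_l cos_0 sin_0; ring.
Qed.

Lemma lineint_rho (l : nat) : (1 <= l)%nat -> lineint (rho l) = 1.
Proof.
intros Hl; transitivity (cosint (rho l) 0).
  apply lineint_ext; intros u; rewrite Rmult_0_l cos_0; ring.
rewrite cosint_rho // cosint_rho1_0; apply pow1.
Qed.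

(** * Taylor expansion of the logarithm with remainder *)

(* [2 Re (log (1 + v (a + i u)))] *)
Definition logker (a u v : R) : R := ln ((1 + a * v) ^ 2 + (u * v) ^ 2).

(** Taylor polynomial in [v] of [- Re (log (1 + v (a + i u)))], so that [logker + 2 * logsum] is a
    remainder. *)
Definition logsum (a u v : R) (N : nat) : R :=
  sum_n (fun r => match r with
                  | O => 0
                  | S _ => negpow_re a u r * v ^ r / INR r
                  end) N.

(* Real part of [n ^ r / (1 - v n)] with [n = - (a + i u)]. *)
Definition geomrem (a u v : R) (r : nat) : R :=
  (negpow_re a u r * (1 + a * v) + negpow_im a u r * (u * v))
  / ((1 + a * v) ^ 2 + (u * v) ^ 2).

(** Real part of [n^r / (1 - v n) = n^r + v n^(r+1) / (1 - v n)]. *)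
Lemma geomrem_step (a u v : R) (r : nat) : (1 + a * v) ^ 2 + (u * v) ^ 2 <> 0 ->
  geomrem a u v r = negpow_re a u r + v * geomrem a u v (S r).
Proof.
intros H; unfold geomrem; rewrite negpow_re_S negpow_im_S; field; exact H.
Qed.

Lemma sum_n_S (a : nat -> R) (n : nat) : sum_n a (S n) = sum_n a n + a (S n).
Proof. apply: sum_Sn. Qed.

(** With [n = - (a + i u)], the geometric sum leaves [- n / (1 - v n) + sum_{r=1}^N n^r v^(r-1) = -
    v^N n^(N+1) / (1 - v n)]. *)
Lemma logker_expansion_derive (a u v : R) (N : nat) : 0 < (1 + a * v) ^ 2 + (u * v) ^ 2 ->
  is_derive (fun w => logker a u w + 2 * logsum a u w N) v (- 2 * (v ^ N * geomrem a u v (S N))).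
Proof.
intros Hd; induction N as [|N IH].
- apply (is_derive_ext (fun w => logker a u w)).
    intros w; unfold logsum; rewrite sum_O; simpl; ring.
  unfold logker; auto_derive; [simpl in Hd; lra|].
  unfold geomrem, negpow_re, negpow_im; simpl; field; simpl in Hd; lra.
- assert (Hp : is_derive (fun w => 2 * (negpow_re a u (S N) * w ^ S N / INR (S N))) v
      (2 * (negpow_re a u (S N) * v ^ N))).
    auto_derive; [easy|].
    change (pred (S N)) with N; field; rewrite -/(INR (S N)); apply not_0_INR; lia.
  apply (is_derive_ext (fun w => (logker a u w + 2 * logsum a u w N)
      + 2 * (negpow_re a u (S N) * w ^ S N / INR (S N)))).
    intros w; unfold logsum; rewrite sum_n_S.
    as_R; ring.
  apply: is_derive_eq (is_derive_plus _ _ _ _ _ IH Hp) _.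
  rewrite (geomrem_step a u v (S N)); [|lra].
  change (- 2 * (v ^ N * (negpow_re a u (S N) + v * geomrem a u v (S (S N))))
    + 2 * (negpow_re a u (S N) * v ^ N) = - 2 * (v ^ S N * geomrem a u v (S (S N)))).
  rewrite -tech_pow_Rmult; ring.
Qed.

(** [d] is the squared modulus of the denominator; [sqrt d >= 1/2] yields
    [|p|, |q| <= sqrt d <= 2 d]. *)
Lemma geomrem_bound (a u v : R) (r : nat) : 1 / 4 <= (1 + a * v) ^ 2 + (u * v) ^ 2 ->
  Rabs (geomrem a u v r) <= 2 * (Rabs a + Rabs u) ^ r.
Proof.
intros Hd; unfold geomrem.
set (p := 1 + a * v) in *; set (q := u * v) in *; set (d := p ^ 2 + q ^ 2) in *.
assert (Hp : Rabs p <= 2 * d).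
  apply Rabs_le; split; unfold d in *; generalize (pow2_ge_0 q) (pow2_ge_0 (p - 1/2))
    (pow2_ge_0 (p + 1/2)); nra.
assert (Hq : Rabs q <= 2 * d).
  apply Rabs_le; split; unfold d in *; generalize (pow2_ge_0 p) (pow2_ge_0 (q - 1/2))
    (pow2_ge_0 (q + 1/2)); nra.
unfold Rdiv; rewrite Rabs_mult Rabs_inv (Rabs_pos_eq d); [|lra].
apply Rmult_le_reg_r with d; [lra|].
rewrite Rmult_assoc Rinv_l ?Rmult_1_r; [|lra].
apply Rle_trans with (1 := Rabs_triang _ _).
rewrite (Rabs_mult _ p) (Rabs_mult _ q).
assert (H := negpow_bound a u r).
assert (HA := Rabs_pos (negpow_re a u r)); assert (HB := Rabs_pos (negpow_im a u r)).
apply Rle_trans with ((Rabs (negpow_re a u r) + Rabs (negpow_im a u r)) * (2 * d)).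
  rewrite Rmult_plus_distr_r; apply Rplus_le_compat; now apply Rmult_le_compat_l.
replace (2 * (Rabs a + Rabs u) ^ r * d) with ((Rabs a + Rabs u) ^ r * (2 * d)) by ring.
apply Rmult_le_compat_r; lra.
Qed.

(** The hypothesis bounds the modulus below instead of fixing the sign of [a]: besides [a = l / 2]
    it must admit [a = -1], [u = 0], which is [log (1 - z)]. *)
Lemma logker_expansion (a u v : R) (N : nat) : 0 <= v ->
  (forall w, 0 <= w <= v -> 1 / 4 <= (1 + a * w) ^ 2 + (u * w) ^ 2) ->
  Rabs (logker a u v + 2 * logsum a u v N) <= 4 * (Rabs a + Rabs u) ^ S N * v ^ S N.
Proof.
intros Hv Hd.
destruct (MVT_closed (fun w => logker a u w + 2 * logsum a u w N)
  (fun w => - 2 * (w ^ N * geomrem a u w (S N))) 0 v Hv) as [c [Hc E]].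
  intros w Hw; apply logker_expansion_derive; generalize (Hd w Hw); lra.
assert (E0 : logker a u 0 + 2 * logsum a u 0 N = 0).
  unfold logker, logsum; rewrite !Rmult_0_r Rplus_0_r.
  replace (1 ^ 2 + 0 ^ 2) with 1 by ring; rewrite ln_1.
  rewrite (sum_n_ext _ (fun _ => 0)).
    rewrite sum_n_const; ring.
  intros [|r]; [easy|]; rewrite pow_i; [unfold Rdiv; rewrite Rmult_0_r; apply Rmult_0_l|lia].
rewrite E0 Rminus_0_r Rminus_0_r in E; rewrite E.
rewrite (Rabs_mult _ v) (Rabs_pos_eq v) // (Rabs_mult (- 2)) (Rabs_mult (c ^ N)) Rabs_Ropp.
rewrite (Rabs_pos_eq 2); [|lra]; rewrite (Rabs_pos_eq (c ^ N)); [|apply pow_le; lra].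
assert (H1 := geomrem_bound a u c (S N) (Hd c Hc)).
assert (H2 : c ^ N <= v ^ N) by (apply pow_incr; lra).
replace (4 * (Rabs a + Rabs u) ^ S N * v ^ S N) with
  (2 * (v ^ N * (2 * (Rabs a + Rabs u) ^ S N)) * v) by (rewrite -(tech_pow_Rmult v); ring).
apply Rmult_le_compat_r; [easy|]; apply Rmult_le_compat_l; [lra|].
apply Rmult_le_compat; auto using Rabs_pos; apply pow_le; lra.
Qed.

(** * Expansion in powers of z *)

Lemma logsum_S (a u v : R) (N : nat) :
  logsum a u v (S N) = logsum a u v N + v ^ S N / INR (S N) * negpow_re a u (S N).
Proof. unfold logsum; rewrite sum_n_S; f_equal; unfold Rdiv; ring. Qed.

Lemma negpow_expdecay (g : R -> R) (a : R) (r : nat) : rholike g ->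
  expdecay 1 (fun u => negpow_re a u r * g u).
Proof.
intros Hg; assert (H := expker_expdecay g a r 0 Hg).
replace (fun u => negpow_re a u r * g u) with (fun u => expker a r 0 u * g u); [exact H|].
apply functional_extensionality; intros u; unfold expker.
rewrite Rmult_0_r Ropp_0 exp_0 Rmult_0_l cos_0 sin_0; ring.
Qed.

Lemma lineint_logsum (g : R -> R) (a v : R) (N : nat) : rholike g ->
  expdecay 1 (fun u => logsum a u v N * g u) /\
  lineint (fun u => logsum a u v N * g u) =
  sum_n (fun r => match r with
                  | O => 0
                  | S _ => v ^ r / INR r * lineint (fun u => negpow_re a u r * g u)
                  end) N.
Proof.
intros Hg; assert (Hg1 : expdecay 1 g) by (apply Hg; lra).
induction N as [|N [IH1 IH2]].
- assert (E : (fun u => logsum a u v 0 * g u) = (fun u => 0 * g u)).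
    apply functional_extensionality; intros u; unfold logsum; now rewrite sum_O.
  rewrite E sum_O; split; [now apply expdecay_scal|].
  rewrite (lineint_scal 1) //; [ring|lra].
- assert (E : (fun u => logsum a u v (S N) * g u) = (fun u => logsum a u v N * g u +
      v ^ S N / INR (S N) * (negpow_re a u (S N) * g u))).
    apply functional_extensionality; intros u; rewrite logsum_S; ring.
  assert (Hn := negpow_expdecay g a (S N) Hg).
  assert (Hns := expdecay_scal 1 (v ^ S N / INR (S N)) _ Hn).
  rewrite E sum_n_S -IH2; split.
    now apply (expdecay_plus 1 (fun u => logsum a u v N * g u)).
  rewrite (lineint_plus 1 (fun u => logsum a u v N * g u)) //; [|lra].
  f_equal; apply (lineint_scal 1 _ (fun u => negpow_re a u (S N) * g u)); [lra|easy].
Qed.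

Lemma logker_continuous (a v : R) : 0 <= a -> 0 <= v ->
  forall u, continuous (fun w => logker a w v) u.
Proof.
intros Ha Hv u; apply: ex_derive_continuous; unfold logker; auto_derive.
assert (0 <= a * v) by nra; nra.
Qed.

Lemma logker_den_ge (a u w : R) : 0 <= a -> 0 <= w -> 1 / 4 <= (1 + a * w) ^ 2 + (u * w) ^ 2.
Proof.
intros Ha Hw; assert (0 <= a * w) by nra; generalize (pow2_ge_0 (u * w)); nra.
Qed.

(** The expansion with [N = 0] says that [logker] grows at most linearly in [u]. *)
Lemma logker_expdecay (g : R -> R) (a v : R) : rholike g -> 0 <= a -> 0 <= v ->
  expdecay 1 (fun u => logker a u v * g u).
Proof.
intros Hg Ha Hv.
destruct (pow_le_exp 1 (Rabs a) (Rabs_pos a)) as [K [HK HKx]].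
apply (expdecay_growth g (fun u => logker a u v) (4 * v * K)); [easy| |now apply logker_continuous|].
  apply Rmult_le_pos; lra.
intros u.
assert (H := logker_expansion a u v 0 Hv (fun w Hw => logker_den_ge a u w Ha (proj1 Hw))).
unfold logsum in H; rewrite sum_O Rmult_0_r Rplus_0_r !pow_1 in H.
apply Rle_trans with (1 := H).
assert (H1 := HKx (Rabs u) (Rabs_pos u)); rewrite pow_1 in H1.
replace (4 * (Rabs a + Rabs u) * v) with (4 * v * (Rabs a + Rabs u)) by ring.
rewrite (Rmult_assoc (4 * v) K); apply Rmult_le_compat_l; [lra|easy].
Qed.

Lemma lineint_logker_expansion (g : R -> R) (a : R) (N : nat) : rholike g -> 0 <= a ->
  exists K, 0 <= K /\ forall v, 0 <= v ->
    Rabs (lineint (fun u => logker a u v * g u) +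
      2 * sum_n (fun r => match r with
                  | O => 0
                  | S _ => v ^ r / INR r * lineint (fun u => negpow_re a u r * g u)
                  end) N) <= K * v ^ S N.
Proof.
intros Hg Ha.
destruct (pow_le_exp (S N) (Rabs a) (Rabs_pos a)) as [K [HK HKx]].
destruct (rholike_growth g Hg) as [C [HC0 HC]].
exists (2 * (4 * K * C) / 1); split.
  unfold Rdiv; rewrite Rinv_1 Rmult_1_r; repeat apply Rmult_le_pos; lra.
intros v Hv; destruct (lineint_logsum g a v N Hg) as [Hs <-].
assert (Hl := logker_expdecay g a v Hg Ha Hv).
rewrite -(lineint_scal 1 2 (fun u => logsum a u v N * g u)) //; [|lra].
assert (Hs2 : expdecay 1 (fun u => 2 * (logsum a u v N * g u))) by now apply expdecay_scal.
rewrite -(lineint_plus 1 (fun u => logker a u v * g u)) //; [|lra].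
assert (Hv0 : 0 <= v ^ S N) by now apply pow_le.
replace (2 * (4 * K * C) / 1 * v ^ S N) with (2 * (4 * K * v ^ S N * C) / 1) by field.
apply lineint_bound; [lra|now apply (expdecay_plus 1 (fun u => logker a u v * g u))|].
intros u; replace (logker a u v * g u + 2 * (logsum a u v N * g u)) with
  ((logker a u v + 2 * logsum a u v N) * g u) by ring.
apply (HC (fun u => logker a u v + 2 * logsum a u v N)).
  apply Rmult_le_pos; lra.
clear u; intros u.
assert (H := logker_expansion a u v N Hv (fun w Hw => logker_den_ge a u w Ha (proj1 Hw))).
apply Rle_trans with (1 := H).
replace (4 * K * v ^ S N * exp (Rabs u)) with (4 * (K * exp (Rabs u)) * v ^ S N) by ring.
apply Rmult_le_compat_r; [easy|]; apply Rmult_le_compat_l; [lra|].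
apply HKx, Rabs_pos.
Qed.

(** Here [x - l / 2 = (1 + a v) / v], and [ln (1 + b u ^ 2)] is [logker a u v - 2 ln (1 + a v)]. As
    [rho l] has mass 1, the terms [ln (1 + a v)] cancel and [(ln v - ln z) / 2 = - ln (1 - z)]
    remains. One factor of [/ 4] is the half line. *)
Lemma rhs_F_logker (l : nat) (z : R) : (1 <= l)%nat -> 0 < z < 1 ->
  rhs_F l z = - ln (1 - z)
    - / 4 * lineint (fun u => logker (INR l / 2) u (z / (1 - z) ^ 2) * rho l u).
Proof.
intros Hl Hz; unfold rhs_F.
assert (Hl1 : 1 <= INR l) by (apply (le_INR 1); lia).
set (a := INR l / 2); set (v := z / (1 - z) ^ 2).
assert (Hz1 : 0 < (1 - z) ^ 2) by (apply pow_lt; lra).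
assert (Hv : 0 < v) by (apply Rdiv_lt_0_compat; lra).
assert (Ha : 0 < a) by (unfold a; lra).
assert (Hav : 0 < 1 + a * v) by nra.
assert (EX : z + / z + INR l - 2 - INR l / 2 = (1 + a * v) / v).
  unfold v, a; field; lra.
rewrite EX.
assert (HX : 0 < (1 + a * v) / v) by now apply Rdiv_lt_0_compat.
rewrite Rabs_pos_eq; [|lra].
assert (Hr := rho_rholike l).
assert (Hr1 : expdecay 1 (rho l)) by (apply Hr; lra).
assert (HL := logker_expdecay (rho l) a v Hr (Rlt_le _ _ Ha) (Rlt_le _ _ Hv)).
assert (Ei : (fun u => ln (1 + / ((1 + a * v) / v) ^ 2 * u ^ 2) * rho l u) =
    (fun u => logker a u v * rho l u + (- 2 * ln (1 + a * v)) * rho l u)).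
  apply functional_extensionality; intros u; rewrite -Rmult_plus_distr_r; f_equal.
  assert (Hu : 0 < 1 + / ((1 + a * v) / v) ^ 2 * u ^ 2).
    assert (0 < / ((1 + a * v) / v) ^ 2) by (apply Rinv_0_lt_compat, pow_lt; lra).
    generalize (pow2_ge_0 u); nra.
  unfold logker.
  replace ((1 + a * v) ^ 2 + (u * v) ^ 2) with
    ((1 + a * v) * (1 + a * v) * (1 + / ((1 + a * v) / v) ^ 2 * u ^ 2)) by (field; lra).
  rewrite ln_mult //; [|nra]; rewrite ln_mult //; ring.
assert (Hd : expdecay 1 (fun u => logker a u v * rho l u + (- 2 * ln (1 + a * v)) * rho l u)).
  apply (expdecay_plus 1 (fun u => logker a u v * rho l u)); [easy|now apply expdecay_scal].
rewrite Ei.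
rewrite (is_RInt_gen_unique _ _ (lineint_even_half 1 _ Rlt_0_1 Hd _)).
  2: { intros u; rewrite (proj1 Hr); unfold logker.
       replace ((- u * v) ^ 2) with ((u * v) ^ 2) by ring; reflexivity. }
rewrite (lineint_plus 1 (fun u => logker a u v * rho l u)) //; [|lra|now apply expdecay_scal].
rewrite (lineint_scal 1 _ (rho l)) //; [|lra].
rewrite lineint_rho //.
rewrite ln_div //.
assert (Ev : ln v = ln z - 2 * ln (1 - z)).
  unfold v; rewrite ln_div; [|lra|easy].
  replace ((1 - z) ^ 2) with ((1 - z) * (1 - z)) by ring.
  rewrite ln_mult; lra.
rewrite Ev; field.
Qed.

(** * Series of [- log (1 - z)] and of the powers of [z / (1 - z)^2] *)

Lemma C_diag (n : nat) : Binomial.C n n = 1.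
Proof.
unfold Binomial.C; rewrite Nat.sub_diag; simpl (INR (Factorial.fact 0)); field.
apply INR_fact_neq_0.
Qed.

(** Division by [1 - z] replaces coefficients by their partial sums; truncation leaves the extra
    term [s M * z ^ S M], and [2] bounds [1 / (1 - z)]. *)
Lemma divide_one_minus (a s : nat -> R) (f K z : R) (M : nat) : 0 < z <= 1 / 2 -> 0 <= K ->
  s O = a O -> (forall m, s (S m) = s m + a (S m)) ->
  Rabs (f - sum_n (fun m => a m * z ^ m) M) <= K * z ^ S M ->
  Rabs (f / (1 - z) - sum_n (fun m => s m * z ^ m) M) <= 2 * (K + Rabs (s M)) * z ^ S M.
Proof.
intros Hz HK H0 HS Hf.
assert (E : (1 - z) * sum_n (fun m => s m * z ^ m) M =
    sum_n (fun m => a m * z ^ m) M - s M * z ^ S M).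
  clear Hf; induction M as [|M IH].
    rewrite !sum_O H0; simpl; ring.
  rewrite !sum_n_S Rmult_plus_distr_l IH HS -(tech_pow_Rmult z (S M)); ring.
assert (Hzp : 0 <= z ^ S M) by (apply pow_le; lra).
apply Rmult_le_reg_l with (1 - z); [lra|].
rewrite -{1}(Rabs_pos_eq (1 - z)); [|lra]; rewrite -Rabs_mult.
replace ((1 - z) * (f / (1 - z) - sum_n (fun m => s m * z ^ m) M)) with
  ((f - sum_n (fun m => a m * z ^ m) M) + s M * z ^ S M).
  2: rewrite Rmult_minus_distr_l E; field; lra.
apply Rle_trans with (1 := Rabs_triang _ _).
rewrite (Rabs_mult (s M)) (Rabs_pos_eq (z ^ S M)) //.
assert (H1 := Rmult_le_pos _ _ (Rplus_le_le_0_compat _ _ HK (Rabs_pos (s M))) Hzp).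
nra.
Qed.

(** Repeated division by [1 - z], starting from the constant series 1; Pascal's rule identifies the
    partial sums. *)
Lemma negbinomial_expansion (k M : nat) : exists K, 0 <= K /\ forall z, 0 < z <= 1 / 2 ->
  Rabs (/ (1 - z) ^ S k - sum_n (fun m => Binomial.C (m + k) k * z ^ m) M) <= K * z ^ S M.
Proof.
induction k as [|k [K [HK IH]]].
- exists (2 * (0 + Rabs 1)); split; [rewrite Rabs_R1; lra|].
  intros z Hz; rewrite pow_1 -(Rmult_1_l (/ (1 - z))).
  rewrite (sum_n_ext _ (fun m => (fun _ => 1) m * z ^ m)).
    apply (divide_one_minus (fun m => match m with O => 1 | S _ => 0 end)); try easy; try lra.
      intros m; ring.
    rewrite (sum_n_ext _ (fun m => match m with O => 1 | S _ => 0 end)).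
      assert (E : sum_n (fun m => match m with O => 1 | S _ => 0 end) M = 1).
        induction M as [|M IHM]; [now rewrite sum_O|rewrite sum_n_S IHM; apply Rplus_0_r].
      rewrite E Rminus_diag Rabs_R0; apply Req_le; ring.
    intros [|m]; [apply Rmult_1_r|apply Rmult_0_l].
  intros m; rewrite Nat.add_0_r pascal_step1; [|lia].
  rewrite Nat.sub_0_r C_diag; reflexivity.
- exists (2 * (K + Rabs (Binomial.C (M + S k) (S k)))); split.
    generalize (Rabs_pos (Binomial.C (M + S k) (S k))); lra.
  intros z Hz.
  replace (/ (1 - z) ^ S (S k)) with (/ (1 - z) ^ S k / (1 - z)).
    2: rewrite -(tech_pow_Rmult _ (S k)); field; split; [apply pow_nonzero|]; lra.
  apply (divide_one_minus (fun m => Binomial.C (m + k) k) (fun m => Binomial.C (m + S k) (S k)));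
    try easy.
  + now rewrite !C_diag.
  + intros m; replace (S m + S k)%nat with (S (m + S k)) by lia.
    rewrite -pascal; [|lia]; replace (S m + k)%nat with (m + S k)%nat by lia; ring.
  + now apply IH.
Qed.

(* Coefficient of [z ^ n] in [- log (1 - z)] if [r = 0], and in
   [(z / (1 - z)^2) ^ r / (2 r)] if [r > 0]. *)
Definition bcoef (n r : nat) : R :=
  if (r <=? n)%nat then Binomial.C (n + r) (2 * r) / INR (n + r) else 0.

Definition bbase (r : nat) (z : R) : R :=
  match r with
  | O => - ln (1 - z)
  | S _ => (z / (1 - z) ^ 2) ^ r / (2 * INR r)
  end.

Definition bpoly (N r : nat) (z : R) : R :=
  sum_n (fun n => match n with O => 0 | S _ => bcoef n r * z ^ n end) N.

(** The absorption identity [C(n, k) / n = C(n - 1, k - 1) / k]. *)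
Lemma bcoef_succ (m r : nat) :
  bcoef (m + S r) (S r) = Binomial.C (m + S (2 * r)) (S (2 * r)) / (2 * INR (S r)).
Proof.
unfold bcoef; replace (S r <=? m + S r)%nat with true by (symmetry; apply Nat.leb_le; lia).
unfold Binomial.C.
replace (m + S r + S r)%nat with (S (m + S (2 * r))) by lia.
replace (2 * S r)%nat with (S (S (2 * r))) by lia.
replace (S (m + S (2 * r)) - S (S (2 * r)))%nat with m by lia.
replace (m + S (2 * r) - S (2 * r))%nat with m by lia.
rewrite (fact_simpl (m + S (2 * r))) (fact_simpl (S (2 * r))) !mult_INR.
replace (INR (S (S (2 * r)))) with (2 * INR (S r)).
  2: rewrite !S_INR mult_INR; simpl; ring.
assert (H1 : INR (S (2 * r)) <> 0) by (apply not_0_INR; lia).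
assert (H3 : INR (S (m + S (2 * r))) <> 0) by (apply not_0_INR; lia).
assert (H4 : INR (S r) <> 0) by (apply not_0_INR; lia).
field; repeat split; first [assumption|exact (INR_fact_neq_0 _)].
Qed.

Lemma bpoly_shift (N r : nat) (z : R) : (S r <= N)%nat ->
  bpoly N (S r) z = z ^ S r / (2 * INR (S r)) *
    sum_n (fun m => Binomial.C (m + S (2 * r)) (S (2 * r)) * z ^ m) (N - S r).
Proof.
assert (Hr : INR (S r) <> 0) by (apply not_0_INR; lia).
assert (Hlow : forall n, (n < S r)%nat -> bpoly n (S r) z = 0).
  intros n; induction n as [|n IH]; intros Hn; unfold bpoly.
    now rewrite sum_O.
  rewrite sum_n_S; fold (bpoly n (S r) z); rewrite IH; [|lia].
  unfold bcoef; replace (S r <=? S n)%nat with false by (symmetry; apply Nat.leb_gt; lia); ring.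
intros HN; induction HN as [|N HN IH].
- unfold bpoly; rewrite sum_n_S; fold (bpoly r (S r) z); rewrite Hlow; [|lia].
  rewrite Nat.sub_diag sum_O; change (S r) with (0 + S r)%nat at 1; rewrite bcoef_succ.
  simpl (z ^ 0); field; exact Hr.
- unfold bpoly; rewrite sum_n_S; fold (bpoly N (S r) z); rewrite IH.
  replace (S N - S r)%nat with (S (N - S r)) by lia.
  rewrite sum_n_S; replace (S N) with (S (N - S r) + S r)%nat at 1 by lia.
  rewrite bcoef_succ; replace (S N) with (S r + S (N - S r))%nat at 1 by lia.
  rewrite pow_add; field; exact Hr.
Qed.

(** The logarithm expansion at [a = -1], [u = 0], where every [negpow_re] is 1. *)
Lemma bbase_expansion_0 (N : nat) (z : R) : 0 < z <= 1 / 2 ->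
  Rabs (bbase 0 z - bpoly N 0 z) <= 2 * z ^ S N.
Proof.
intros Hz.
assert (H := logker_expansion (-1) 0 z N).
assert (El : logker (-1) 0 z = 2 * ln (1 - z)).
  unfold logker; replace ((1 + -1 * z) ^ 2 + (0 * z) ^ 2) with ((1 - z) * (1 - z)) by ring.
  rewrite ln_mult; lra.
assert (En : forall r, negpow_re (-1) 0 r = 1 /\ negpow_im (-1) 0 r = 0).
  induction r as [|r [I1 I2]]; [split; reflexivity|].
  rewrite negpow_re_S negpow_im_S I1 I2; split; ring.
assert (Es : logsum (-1) 0 z N = bpoly N 0 z).
  unfold logsum, bpoly; apply sum_n_ext; intros [|r]; [easy|].
  rewrite (proj1 (En _)); unfold bcoef.
  replace (0 <=? S r)%nat with true by easy.
  rewrite Nat.mul_0_r Nat.add_0_r.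
  assert (EC : Binomial.C (S r) 0 = 1).
    rewrite pascal_step1; [|lia]; rewrite Nat.sub_0_r; apply C_diag.
  rewrite EC /Rdiv !Rmult_1_l Rmult_comm; reflexivity.
rewrite El Es Rabs_R0 in H.
replace (Rabs (-1) + 0) with 1 in H by (rewrite Rabs_left; lra).
rewrite pow1 in H; simpl bbase.
replace (- ln (1 - z) - bpoly N 0 z) with (- / 2 * (2 * ln (1 - z) + 2 * bpoly N 0 z)) by field.
rewrite Rabs_mult Rabs_Ropp (Rabs_pos_eq (/ 2)); [|lra].
assert (H' : Rabs (2 * ln (1 - z) + 2 * bpoly N 0 z) <= 4 * 1 * z ^ S N).
  apply H; [lra|]; intros w Hw; nra.
lra.
Qed.

(** For positive index the prefactor [z ^ S r] accounts for [S r] orders, so the negative binomial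
    series is cut at [N - S r]. *)
Lemma bbase_expansion (N r : nat) : (r <= N)%nat -> exists K, 0 <= K /\
  forall z, 0 < z <= 1 / 2 -> Rabs (bbase r z - bpoly N r z) <= K * z ^ S N.
Proof.
destruct r as [|r]; intros HN.
  exists 2; split; [lra|]; intros z Hz; now apply bbase_expansion_0.
destruct (negbinomial_expansion (S (2 * r)) (N - S r)) as [K [HK H]].
assert (Hr : 0 < INR (S r)) by (apply lt_0_INR; lia).
exists (K / (2 * INR (S r))); split; [apply Rdiv_le_0_compat; lra|].
intros z Hz; rewrite bpoly_shift //.
assert (E : bbase (S r) z = z ^ S r / (2 * INR (S r)) * / (1 - z) ^ S (S (2 * r))).
  unfold bbase, Rdiv; rewrite Rpow_mult_distr pow_inv -pow_mult.
  replace (2 * S r)%nat with (S (S (2 * r))) by lia; ring.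
rewrite E -Rmult_minus_distr_l Rabs_mult.
assert (Hzr : 0 <= z ^ S r / (2 * INR (S r))).
  apply Rdiv_le_0_compat; [apply pow_le|]; lra.
rewrite (Rabs_pos_eq _ Hzr).
apply Rle_trans with (z ^ S r / (2 * INR (S r)) * (K * z ^ S (N - S r))).
  now apply Rmult_le_compat_l; [|apply H].
apply Req_le; replace (S N) with (S r + S (N - S r))%nat by lia.
rewrite pow_add; field; lra.
Qed.

Lemma sum_n_abs_bound (f : nat -> R -> R) (P : R -> Prop) (w : R -> R) (N : nat) :
  (forall z, P z -> 0 <= w z) ->
  (forall r, (r <= N)%nat -> exists K, 0 <= K /\ forall z, P z -> Rabs (f r z) <= K * w z) ->
  exists K, 0 <= K /\ forall z, P z -> Rabs (sum_n (fun r => f r z) N) <= K * w z.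
Proof.
intros Hw; induction N as [|N IH]; intros H.
- destruct (H O) as [K [HK HKz]]; [lia|]; exists K; split; [easy|].
  intros z Hz; rewrite sum_O; now apply HKz.
- destruct IH as [K1 [HK1 H1]]; [intros r Hr; apply H; lia|].
  destruct (H (S N)) as [K2 [HK2 H2]]; [lia|].
  exists (K1 + K2); split; [lra|]; intros z Hz; rewrite sum_n_S.
  apply Rle_trans with (1 := Rabs_triang _ _).
  generalize (H1 z Hz) (H2 z Hz); lra.
Qed.

Lemma sum_n_zero_tail (f : nat -> R) (n N : nat) : (n <= N)%nat ->
  (forall r, (n < r)%nat -> f r = 0) -> sum_n f N = sum_n f n.
Proof.
intros HN H0; induction HN as [|N HN IH]; [easy|].
rewrite sum_n_S IH H0; [apply Rplus_0_r|lia].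
Qed.

(** The zeros of [bcoef] for [r > n] make the range independent of [n], so that the double sum
    becomes a square and can be transposed. *)
Lemma Bstar_bcoef (l n N : nat) : (n <= N)%nat ->
  Bstar l n = sum_n (fun r => bcoef n r * bernoulli_l l r) N.
Proof.
intros HN; rewrite (sum_n_zero_tail _ n N HN).
- unfold Bstar; apply sum_n_ext_loc; intros r Hr; unfold bcoef.
  replace (r <=? n)%nat with true by (symmetry; now apply Nat.leb_le).
  unfold Rdiv; as_R; ring.
- intros r Hr; unfold bcoef.
  replace (r <=? n)%nat with false by (symmetry; now apply Nat.leb_gt); ring.
Qed.

Lemma sum_Bstar_bpoly (l N : nat) (z : R) :
  sum_n (fun n => match n with O => 0 | S _ => Bstar l n * z ^ n end) N =
  sum_n (fun r => bernoulli_l l r * bpoly N r z) N.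
Proof.
set (t := fun r n => match n with O => 0 | S _ => bernoulli_l l r * (bcoef n r * z ^ n) end).
transitivity (sum_n (fun n => sum_n (fun r => t r n) N) N).
- apply sum_n_ext_loc; intros [|n] Hn.
    unfold t; rewrite sum_n_const; as_R; ring.
  rewrite (Bstar_bcoef l (S n) N Hn) Rmult_comm.
  apply: eq_trans; [symmetry; apply: (sum_n_mult_l (z ^ S n))|].
  apply sum_n_ext; intros r; unfold t, mult; simpl; as_R; ring.
- rewrite sum_n_switch; apply sum_n_ext; intros r.
  apply: eq_trans; [|apply: (sum_n_mult_l (bernoulli_l l r))].
  apply sum_n_ext; intros [|n]; unfold t, mult; simpl; as_R; ring.
Qed.

(* sum_{n>=1} B_n^(l)* z^n is the asymptotic expansion of rhs_F l z as z -> 0+ :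
   for every N, the remainder after the terms n = 1..N is O(z^(N+1)). *)
Theorem theorem1p4 (l : nat) (hl : (1 <= l)%nat) :
  forall N : nat, exists (K delta : R), 0 < delta /\
    forall z : R, 0 < z < delta ->
      Rabs (rhs_F l z - sum_n (fun n => match n with O => 0 | S _ => Bstar l n * z ^ n end) N)
        <= K * z ^ (S N).
Proof.
intros N.
assert (Ha : 0 <= INR l / 2) by (generalize (pos_INR l); lra).
destruct (lineint_logker_expansion (rho l) (INR l / 2) N (rho_rholike l) Ha) as [K1 [HK1 H1]].
destruct (sum_n_abs_bound (fun r z => bernoulli_l l r * (bbase r z - bpoly N r z))
  (fun z => 0 < z <= 1 / 2) (fun z => z ^ S N) N) as [K2 [HK2 H2]].
- intros z Hz; apply pow_le; lra.
- intros r Hr; destruct (bbase_expansion N r Hr) as [K [HK H]].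
  exists (Rabs (bernoulli_l l r) * K); split; [apply Rmult_le_pos; auto using Rabs_pos|].
  intros z Hz; rewrite Rabs_mult Rmult_assoc.
  apply Rmult_le_compat_l; [apply Rabs_pos|now apply H].
(* For [z < 1/2], [v <= 4 z] converts the remainder in [v] into one in [z]; [K2] covers the
   truncations of the functions [bbase r]. *)
- exists (/ 4 * (K1 * 4 ^ S N) + K2), (1 / 2); split; [lra|]; intros z Hz.
  rewrite sum_Bstar_bpoly rhs_F_logker //; [|lra].
  assert (Hz1 : 1 / 4 <= (1 - z) ^ 2) by nra.
  set (v := z / (1 - z) ^ 2).
  assert (Hv : 0 <= v <= 4 * z).
    unfold v; split; [apply Rdiv_le_0_compat; lra|].
    apply Rmult_le_reg_r with ((1 - z) ^ 2); [lra|].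
    unfold Rdiv; rewrite Rmult_assoc Rinv_l; nra.
  assert (Hv1 := H1 v (proj1 Hv)).
  set (I := lineint (fun u => logker (INR l / 2) u v * rho l u)) in *.
  (* The moment identity enters here; the term [r = 0] contributes [- ln (1 - z)] because
     [B_0 = 1]. *)
  assert (ES : sum_n (fun r => bernoulli_l l r * bbase r z) N =
    - ln (1 - z) + / 2 * sum_n (fun r => match r with
                  | O => 0
                  | S _ => v ^ r / INR r * lineint (fun u => negpow_re (INR l / 2) u r * rho l u)
                  end) N).
    assert (E0 : bernoulli_l l 0 = 1).
      unfold bernoulli_l, bern_gen; simpl; now destruct (Req_EM_T 0 0).
    clear -E0 hl; induction N as [|N IH].
      rewrite !sum_O E0; simpl; as_R; ring.
    rewrite !sum_n_S IH bernoulli_l_lineint //; unfold bbase; fold v.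
    as_R; field; apply not_0_INR; lia.
  assert (Hz2 := H2 z ltac:(lra)).
  assert (ED : forall M, sum_n (fun r => bernoulli_l l r * (bbase r z - bpoly N r z)) M =
     sum_n (fun r => bernoulli_l l r * bbase r z) M
     - sum_n (fun r => bernoulli_l l r * bpoly N r z) M).
    intros M; induction M as [|M IH].
      rewrite !sum_O; as_R; ring.
    rewrite !sum_n_S IH; as_R; ring.
  rewrite ED ES in Hz2.
  set (S1 := sum_n _ N) in Hv1, Hz2; set (S2 := sum_n _ N) in Hz2 |- *.
  (* Adding and subtracting [/ 2 * S1] separates the Taylor remainder of the logarithm from the
     truncation error in [z]. *)
  replace (- ln (1 - z) - / 4 * I - S2) with
    (- / 4 * (I + 2 * S1) + (- ln (1 - z) + / 2 * S1 - S2)) by field.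
  apply Rle_trans with (1 := Rabs_triang _ _).
  rewrite Rabs_mult Rabs_Ropp (Rabs_pos_eq (/ 4)); [|lra].
  assert (Hvp : v ^ S N <= 4 ^ S N * z ^ S N).
    rewrite -Rpow_mult_distr; apply pow_incr; lra.
  assert (H3 := Rmult_le_compat_l _ _ _ HK1 Hvp).
  lra.
Qed.
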